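(* Let $U\subseteq\mathbf{R}^d$ be open and let $u\in\mathcal{D}'(U)$. Then $$\mathrm{WF}(u)\subseteq \mathrm{WF}_{0,1}(u)\subseteq \mathrm{WF}_{\infty,1}(u)\subseteq \mathrm{WF}_{0,\infty}(u)\subseteq \mathrm{WF}_{\infty,\infty}(u)\subseteq \bigcap_{t>1}\mathrm{WF}_t(u),$$ where $\mathrm{WF}$ is the classical ($C^\infty$) wave front set and $\mathrm{WF}_t$ is the Gevrey wave front set.
   Context: $\mathcal{D}'(U)$ denotes the Schwartz distributions on $U$, $\mathcal{E}'(U)$ the compactly supported ones, $\mathbf{N}=\{0,1,2,\dots\}$, and $\lfloor\cdot\rfloor$ is the floor function. The Fourier transform is $\widehat f(\xi)=\int_{\mathbf{R}^d}f(x)e^{-2\pi i x\xi}\,dx$, extended to distributions by duality. A conic neighborhood of $\xi_0\in\mathbf{R}^d\setminus\{0\}$ is an open cone $\Gamma\subset\mathbf{R}^d$ with $\xi_0\in\Gamma$. Wave front sets: let $\tau>0$, $\sigma>1$, $(x_0,\xi_0)\in U\times(\mathbf{R}^d\setminus\{0\})$. Then $(x_0,\xi_0)\notin \mathrm{WF}_{\{\tau,\sigma\}}(u)$ (resp. $(x_0,\xi_0)\notin\mathrm{WF}_{(\tau,\sigma)}(u)$) if there exist an open neighborhood $\Omega\subset U$ of $x_0$, a conic neighborhood $\Gamma$ of $\xi_0$, and a bounded sequence $\{u_N\}_{N\in\mathbf{N}}$ in $\mathcal{E}'(U)$ such that $u_N=u$ on $\Omega$ for every $N$ and $$|\widehat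 u_N(\xi)|\le A\,\frac{h^N N!^{\tau/\sigma}}{|\xi|^{\lfloor N^{1/\sigma}\rfloor}},\qquad N\in\mathbf{N},\ \xi\in\Gamma\setminus\{0\},$$ for some constants $A,h>0$ (resp. for every $h>0$ there exists $A>0$ such that this holds). $\mathrm{WF}_{\tau,\sigma}$ stands for either $\mathrm{WF}_{\{\tau,\sigma\}}$ or $\mathrm{WF}_{(\tau,\sigma)}$; in the unions and intersections below both choices give the same sets. Put $$\mathrm{WF}_{0,1}(u)=\bigcap_{\sigma>1}\bigcap_{\tau>0}\mathrm{WF}_{\tau,\sigma}(u),\qquad \mathrm{WF}_{\infty,1}(u)=\bigcap_{\sigma>1}\bigcup_{\tau>0}\mathrm{WF}_{\tau,\sigma}(u),$$ $$\mathrm{WF}_{0,\infty}(u)=\bigcup_{\sigma>1}\bigcap_{\tau>0}\mathrm{WF}_{\tau,\sigma}(u),\qquad \mathrm{WF}_{\infty,\infty}(u)=\bigcup_{\sigma>1}\bigcup_{\tau>0}\mathrm{WF}_{\tau,\sigma}(u).$$ Gevrey wave front set, $t>1$: $(x_0,\xi_0)\notin\mathrm{WF}_t(u)$ if and only if there exist an open neighborhood $\Omega$ of $x_0$, a conic neighborhood $\Gamma$ of $\xi_0$ and a bounded sequence $u_N\in\mathcal{E}'(U)$ with $u_N=u$ on $\Omega$ and $|\widehat u_N(\xi)|\le A\,h^N N!^t/|\xi|^N$ for all positive integers $N$ and $\xi\in\Gamma\setminus\{0\}$, for some $A,h>0$. *)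

(* Defs.v *)
From HB Require Import structures.
From mathcomp Require Import all_boot all_order all_algebra.
From mathcomp Require Import all_classical all_reals all_analysis.
From mathcomp.real_closed Require Import complex.

Set Implicit Arguments.
Unset Strict Implicit.
Unset Printing Implicit Defensive.

Import Order.TTheory GRing.Theory Num.Theory.
Import numFieldNormedType.Exports.

Local Open Scope classical_set_scope.
Local Open Scope ring_scope.
Local Open Scope complex_scope.

Section Smooth.
Context {R : realType} {d : nat}.
Local Notation V := 'rV[R]_d.
Local Notation fct := (V -> R[i]).

Definition cmod (z : R[i]) : R := Normc.normc z.

Definition dotv (x y : V) : R := \sum_(i < d) x 0 i * y 0 i.

(* The library norm on 'rV_d is the sup norm, hence this separate definition. *)
Definition enorm (x : V) : R := Num.sqrt (dotv x x).

Definition partialC (i : 'I_d) (f : fct) : fct := fun x =>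
  'D_(delta_mx 0 i) (fun y => complex.Re (f y)) x +i*
  'D_(delta_mx 0 i) (fun y => complex.Im (f y)) x.

(* Sequences of directions play the role of multi-indices; for smooth functions
   the order of the partial derivatives is irrelevant. *)
Definition mpartial (s : seq 'I_d) (f : fct) : fct := foldr partialC f s.

Definition partiable (f : fct) (x : V) : Prop := forall i : 'I_d,
  derivable (fun y => complex.Re (f y)) x (delta_mx 0 i) /\
  derivable (fun y => complex.Im (f y)) x (delta_mx 0 i).

Definition continuousC_at (f : fct) (x : V) : Prop :=
  {for x, continuous (fun y => complex.Re (f y))} /\
  {for x, continuous (fun y => complex.Im (f y))}.

(* C^oo(U) for U open; f is a total function whose values off U are junk. *)
Definition smooth_on (U : set V) (f : fct) : Prop :=
  forall (s : seq 'I_d) (x : V), U x ->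
    continuousC_at (mpartial s f) x /\ partiable (mpartial s f) x.

Definition supported_in (K : set V) (f : fct) : Prop :=
  forall x, ~ K x -> f x = 0.

(* C_c^oo(U), each element being extended by 0 to the whole space. *)
Definition test_fun (U : set V) (phi : fct) : Prop :=
  smooth_on setT phi /\
  exists K, [/\ compact K, K `<=` U & supported_in K phi].

(* sup of |d^a f| over K and |a| <= k *)
Definition Cnorm (K : set V) (k : nat) (f : fct) : R :=
  sup [set y : R | exists (s : seq 'I_d) (x : V),
         [/\ (size s <= k)%N, K x & y = cmod (mpartial s f x)]].

End Smooth.

Section Distributions.
Context {R : realType} {d : nat}.
Local Notation V := 'rV[R]_d.
Local Notation fct := (V -> R[i]).

(* u in D'(U); the values of u off C_c^oo(U) are junk. *)
Definition schwartz_distr (U : set V) (u : fct -> R[i]) : Prop :=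
  (forall (a : R[i]) (phi psi : fct), test_fun U phi -> test_fun U psi ->
     u (fun x => a * phi x + psi x) = a * u phi + u psi) /\
  (forall K, compact K -> K `<=` U ->
     exists (C : R) (k : nat), forall phi, smooth_on setT phi ->
       supported_in K phi -> cmod (u phi) <= C * Cnorm K k phi).

Definition dist_eq_on (W : set V) (u v : fct -> R[i]) : Prop :=
  forall phi, test_fun W phi -> u phi = v phi.

Definition dist_support (U : set V) (u : fct -> R[i]) : set V :=
  [set x | U x /\ ~ exists W, [/\ open W, W x, W `<=` U &
                                  dist_eq_on W u (fun=> 0)]].

(* u in E'(U) *)
Definition compact_distr (U : set V) (u : fct -> R[i]) : Prop :=
  schwartz_distr U u /\ compact (dist_support U u).

Definition dist_mul (phi : fct) (u : fct -> R[i]) : fct -> R[i] :=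
  fun psi => u (fun x => phi x * psi x).

Definition is_cutoff (U K : set V) (chi : fct) : Prop :=
  test_fun U chi /\
  exists W, [/\ open W, K `<=` W & forall x, W x -> chi x = 1].

(* The pairing of u in E'(U) with psi in C^oo(U), i.e. u (chi psi) for any
   cutoff chi equal to 1 near the support of u; the choice is irrelevant. *)
Definition cpair (U : set V) (u : fct -> R[i]) (psi : fct) : R[i] :=
  u (fun x => xget (fun=> 0) [set chi | is_cutoff U (dist_support U u) chi] x
              * psi x).

(* x |-> exp (- 2 i pi x xi) *)
Definition fourier_exp (xi : V) : fct := fun x =>
  let t := - (2 * pi * dotv x xi) in cos t +i* sin t.

(* The Fourier transform of u in E'(U), a function on R^d. *)
Definition cfourier (U : set V) (u : fct -> R[i]) (xi : V) : R[i] :=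
  cpair U u (fourier_exp xi).

(* Bounded subsets of the Frechet space C^oo(U). *)
Definition bounded_smooth (U : set V) (B : set fct) : Prop :=
  (forall psi, B psi -> smooth_on U psi) /\
  forall (K : set V) (k : nat), compact K -> K `<=` U ->
    exists M : R, forall psi, B psi -> Cnorm K k psi <= M.

(* Bounded sequences of E'(U), for the strong dual topology. *)
Definition bounded_cdist_seq (U : set V) (uN : nat -> fct -> R[i]) : Prop :=
  (forall N, compact_distr U (uN N)) /\
  forall B, bounded_smooth U B ->
    exists M : R, forall N psi, B psi -> cmod (cpair U (uN N) psi) <= M.

End Distributions.

Section WaveFront.
Context {R : realType} {d : nat}.
Local Notation V := 'rV[R]_d.
Local Notation fct := (V -> R[i]).

Definition conic_nbhd (xi0 : V) (G : set V) : Prop :=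
  [/\ open G, (forall (t : R) (xi : V), 0 < t -> G xi -> G (t *: xi)) & G xi0].

Definition open_nbhd_in (U : set V) (x0 : V) (W : set V) : Prop :=
  [/\ open W, W `<=` U & W x0].

Definition WF (U : set V) (u : fct -> R[i]) : set (V * V) :=
  [set p | [/\ U p.1, p.2 != 0 & ~
    exists phi G, [/\ test_fun U phi, phi p.1 != 0, conic_nbhd p.2 G &
      forall k : nat, exists C : R, forall xi, G xi ->
        cmod (cfourier U (dist_mul phi u) xi) <= C / (1 + enorm xi) ^+ k]]].

(* Roumieu : WF_{tau,sigma} with braces; Beurling : with parentheses. *)
Inductive WF_kind := Roumieu | Beurling.

Definition ext_gevrey_decay (U : set V) (uN : nat -> fct -> R[i]) (G : set V)
    (tau sigma A h : R) : Prop :=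
  forall (N : nat) (xi : V), G xi -> xi != 0 ->
    cmod (cfourier U (uN N) xi) <=
      A * (h ^+ N * (N`!)%:R `^ (tau / sigma)
           / enorm xi ^ Num.floor (N%:R `^ sigma^-1 : R)).

Definition ext_gevrey_decay_kind (kind : WF_kind) (U : set V)
    (uN : nat -> fct -> R[i]) (G : set V) (tau sigma : R) : Prop :=
  match kind with
  | Roumieu => exists A h : R,
      [/\ 0 < A, 0 < h & ext_gevrey_decay U uN G tau sigma A h]
  | Beurling => forall h : R, 0 < h ->
      exists2 A : R, 0 < A & ext_gevrey_decay U uN G tau sigma A h
  end.

Definition WF_ext_gevrey (kind : WF_kind) (tau sigma : R) (U : set V)
    (u : fct -> R[i]) : set (V * V) :=
  [set p | [/\ U p.1, p.2 != 0 & ~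
    exists W G uN, [/\ open_nbhd_in U p.1 W, conic_nbhd p.2 G,
      bounded_cdist_seq U uN, (forall N, dist_eq_on W (uN N) u) &
      ext_gevrey_decay_kind kind U uN G tau sigma]]].

Definition WF_gevrey (t : R) (U : set V) (u : fct -> R[i]) : set (V * V) :=
  [set p | [/\ U p.1, p.2 != 0 & ~
    exists W G uN, [/\ open_nbhd_in U p.1 W, conic_nbhd p.2 G,
      bounded_cdist_seq U uN, (forall N, dist_eq_on W (uN N) u) &
      exists A h : R, [/\ 0 < A, 0 < h &
        forall (N : nat) (xi : V), (0 < N)%N -> G xi -> xi != 0 ->
          cmod (cfourier U (uN N) xi) <=
            A * (h ^+ N * (N`!)%:R `^ t / enorm xi ^+ N)]]]].

Definition WF_0_1 (kind : WF_kind) (U : set V) (u : fct -> R[i]) :=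
  \bigcap_(sigma in [set s : R | 1 < s]) \bigcap_(tau in [set t : R | 0 < t])
    WF_ext_gevrey kind tau sigma U u.

Definition WF_oo_1 (kind : WF_kind) (U : set V) (u : fct -> R[i]) :=
  \bigcap_(sigma in [set s : R | 1 < s]) \bigcup_(tau in [set t : R | 0 < t])
    WF_ext_gevrey kind tau sigma U u.

Definition WF_0_oo (kind : WF_kind) (U : set V) (u : fct -> R[i]) :=
  \bigcup_(sigma in [set s : R | 1 < s]) \bigcap_(tau in [set t : R | 0 < t])
    WF_ext_gevrey kind tau sigma U u.

Definition WF_oo_oo (kind : WF_kind) (U : set V) (u : fct -> R[i]) :=
  \bigcup_(sigma in [set s : R | 1 < s]) \bigcup_(tau in [set t : R | 0 < t])
    WF_ext_gevrey kind tau sigma U u.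

End WaveFront.

(* Main.v *)
Require Import Defs.
From mathcomp Require Import all_boot all_order all_algebra.
From mathcomp Require Import all_classical all_reals all_analysis.
From mathcomp.real_closed Require Import complex.
From mathcomp Require Import ring lra.
From mathcomp Require finmap.
Import Order.TTheory GRing.Theory Num.Theory.
Import numFieldNormedType.Exports.
Local Open Scope classical_set_scope.
Local Open Scope ring_scope.
Local Open Scope complex_scope.

(** The second and fourth inclusions hold because an intersection over tau is
contained in the corresponding union.

The third and fifth inclusions come from reindexing the sequences of the
definition.  Suppose that u_N has Fourier decay of order e(N) on a cone, with
constants growing like N!^s.  The sequence N |-> u_(M(N)) has order e(M(N)),
and if M(N) is about N^a with a < 1, then (M(N))!^s is at most exponential in
N ([fact_subexp]), hence is absorbed by any factor h^N N!^tau' with h and tau'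
positive, however small ([gevrey_absorb]).  So regularity for the index sigma and
a single tau implies regularity for every larger sigma' and every tau', in both
the Roumieu and the Beurling sense ([WF_ext_gevrey_mono]), and Gevrey regularity
implies all the extended ones ([WF_ext_gevrey_gevrey]).  On the low frequencies
the negative powers of |xi| only help, and there the boundedness of (u_N) in
E'(U) is enough ([reindex_decay]).

The first inclusion is the classical fact that Fourier decay survives
localization.  Let u_N be a sequence which witnesses that a point is outside the
extended Gevrey wave front set, and let phi be a product of bumps in the single
coordinates, supported where every u_N equals u.  Given k, choose N with
N^(1/sigma) >= k, so that v = u_N satisfies |v^(xi)| <= C |xi|^(-k) on the cone.
Then the Fourier transform of phi u is that of phi v, and what is needed is that
multiplication by phi preserves the decay of order k on a smaller cone.  This is
expressed by an estimate in the style of Peetre, |F(xi + z)| (1 + |xi|)^k <=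
C (1 + |z|)^p for xi in the small cone and z arbitrary ([peetre_decay]): it follows
once from polynomial growth together with decay on the large cone
([peetre_decay_cone]) and, the shift z being arbitrary, it is then stable under
any superposition of frequency shifts with rapidly decreasing weights, without
further shrinking of the cone.

Multiplication by a smooth function b of one coordinate is such a superposition
([peetre_decay_mul]).  Rather than expanding b in a Fourier integral, one
uses that v has compact support: on an interval that contains the coordinates of the
support, b is the limit, with all its derivatives, of the Fejer means of a
periodic extension ([trig_approx]).  These are finite sums of exponentials
whose coefficients decay rapidly, uniformly along the sequence, by integration by parts
([fourier_decay], [fejer_weight]); the convergence follows from the closed form
(1 - cos t) K_m(t) = 1 - cos (m t) of the Fejer kernel K_m of mass 2 pi m
([fejer_kernel_closed]). *)

Set Implicit Arguments.
Unset Strict Implicit.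
Unset Printing Implicit Defensive.

(** * Smooth functions of one variable *)

Section OneVariable.
Local Open Scope classical_set_scope.
Context {R : realType}.
Implicit Types (f g : R -> R) (n : nat).

(** Stating n-fold differentiability by recursion on the derivative, rather than
through the iterated derivatives, makes products and inverses go through by
induction on n, with no Leibniz formula. *)
Fixpoint diffn n g : Prop :=
  (forall x, derivable g x 1) /\ (if n is m.+1 then diffn m g^`() else True).

Definition smooth1 g := forall n, diffn n g.

Lemma diffnW n g : diffn n.+1 g -> diffn n g.
Proof.
elim: n g => [|n IH] g /=; first by case=> ? _.
by move=> [dg dg']; split=> //; exact: IH.
Qed.

Lemma smooth1_deriv g : smooth1 g -> smooth1 g^`().
Proof. by move=> sg n; have [] := sg n.+1. Qed.

Lemma smooth1_derivn n g : smooth1 g -> smooth1 g^`(n).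
Proof.
by elim: n g => [|n IH] g sg //; rewrite derive1Sn; apply: IH; exact: smooth1_deriv.
Qed.

Lemma smooth1_derivable g x : smooth1 g -> derivable g x 1.
Proof. by move=> /(_ 0%N) [+ _]; exact. Qed.

Lemma smooth1_continuous g : smooth1 g -> continuous g.
Proof.
move=> sg x; apply: differentiable_continuous.
exact/derivable1_diffP/smooth1_derivable.
Qed.

Lemma diffn_cst n (c : R) : diffn n (cst c).
Proof.
elim: n c => [|n IH] c /=; split=> //; rewrite (_ : _^`() = cst 0)//.
by apply/funext => x; rewrite derive1_cst.
Qed.

Lemma deriv1D f g : (forall x, derivable f x 1) -> (forall x, derivable g x 1) ->
  (f \+ g)^`() = f^`() \+ g^`().
Proof. by move=> df dg; apply/funext => x; rewrite /= !derive1E deriveD. Qed.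

Lemma deriv1M f g : (forall x, derivable f x 1) -> (forall x, derivable g x 1) ->
  (f \* g)^`() = (f \* g^`()) \+ (g \* f^`()).
Proof.
by move=> df dg; apply/funext => x; rewrite /= !derive1E deriveM.
Qed.

Lemma diffnD n f g : diffn n f -> diffn n g -> diffn n (f \+ g).
Proof.
elim: n f g => [|n IH] f g /= [df df'] [dg dg'];
  (split; first by move=> x; exact: derivableD); first exact: I.
by rewrite (deriv1D df dg); exact: IH.
Qed.

Lemma diffnM n f g : diffn n f -> diffn n g -> diffn n (f \* g).
Proof.
elim: n f g => [|n IH] f g; first by move=> [df _] [dg _]; split; [move=> x; exact: derivableM | exact: I].
move=> Hf Hg; have [df df'] := Hf; have [dg dg'] := Hg.
split; first by move=> x; exact: derivableM.
rewrite (deriv1M df dg); apply: diffnD; apply: IH.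
- exact: diffnW Hf.
- exact: dg'.
- exact: diffnW Hg.
- exact: df'.
Qed.

(** Induction through (1/g)' = - (1/g)^2 g', whose right-hand side only involves
1/g at the previous order. *)
Lemma diffnV n g : (forall x, g x != 0) -> diffn n g -> diffn n (fun x => (g x)^-1).
Proof.
move=> g0; elim: n => [|n IH].
  by move=> [dg _]; split; [move=> x; exact: derivableV | exact: I].
move=> Hg; have [dg dg'] := Hg; split; first by move=> x; exact: derivableV.
have iV := IH (diffnW Hg).
rewrite (_ : _^`() = (cst (-1) \* ((fun x => (g x)^-1) \* (fun x => (g x)^-1)))
   \* g^`()).
  by apply: diffnM => //; apply: diffnM; [exact: diffn_cst | exact: diffnM].
apply/funext => x; rewrite derive1E (deriveV (g0 x) (dg x)) -derive1E /= expr2 invfM.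
by rewrite /GRing.scale/= mulN1r.
Qed.

Lemma is_derive_affine (a c x : R) : is_derive x (1 : R) (fun t => a * t + c) a.
Proof. by apply: is_derive_eq; rewrite addr0; exact: mulr1. Qed.

Lemma diffn_comp_affine n g (a c : R) :
  diffn n g -> diffn n (fun x => g (a * x + c)).
Proof.
elim: n g => [|n IH] g.
  move=> [dg _]; split; last exact: I.
  move=> x.
  apply/derivable1_diffP; apply: (@differentiable_comp _ _ _ _ (fun x => a * x + c) g).
    exact/derivable1_diffP.
  exact/derivable1_diffP.
move=> [dg dg'].
have da x : derivable (fun x => a * x + c) x 1 by case: (is_derive_affine a c x).
split.
  move=> x; apply/derivable1_diffP.
  apply: (@differentiable_comp _ _ _ _ (fun x => a * x + c) g); exact/derivable1_diffP.
rewrite (_ : _^`() = (fun x => g^`() (a * x + c)) \* cst a).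
  by apply: diffnM; [exact: IH|exact: diffn_cst].
apply/funext => x; rewrite [LHS](derive1_comp (da x) (dg _)) /=.
by congr (_ * _); rewrite derive1E (@derive_val _ _ _ _ _ _ _ (is_derive_affine a c x)).
Qed.

Lemma smooth1_cst c : smooth1 (cst c).
Proof. by move=> n; exact: diffn_cst. Qed.
Lemma smooth1_id : smooth1 (@id R).
Proof.
move=> n; case: n => [|n]; (split; first by move=> x; exact: derivable_id).
  exact: I.
rewrite (_ : id^`() = cst 1); first exact: diffn_cst.
by apply/funext => x; rewrite derive1_id.
Qed.
Lemma smooth1D f g : smooth1 f -> smooth1 g -> smooth1 (f \+ g).
Proof. by move=> sf sg n; exact: diffnD. Qed.
Lemma smooth1M f g : smooth1 f -> smooth1 g -> smooth1 (f \* g).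
Proof. by move=> sf sg n; exact: diffnM. Qed.
Lemma smooth1V g : (forall x, g x != 0) -> smooth1 g -> smooth1 (fun x => (g x)^-1).
Proof. by move=> g0 sg n; exact: diffnV. Qed.
Lemma smooth1_affine g a c : smooth1 g -> smooth1 (fun x => g (a * x + c)).
Proof. by move=> sg n; exact: diffn_comp_affine. Qed.

Lemma smooth1_trig : smooth1 (@cos R) /\ smooth1 (@sin R).
Proof.
suff H n : diffn n (@cos R) /\ diffn n (@sin R) by split=> n; case: (H n).
have dsin : (@sin R)^`() = cos.
  by apply/funext => x; rewrite derive1E; apply: derive_val.
have dcos : (@cos R)^`() = cst (-1) \* sin.
  by apply/funext => x; rewrite derive1E /= mulN1r; apply: derive_val.
elim: n => [|n [IHc IHs]] //=; split; split => //.
  by rewrite dcos; apply: diffnM => //; exact: diffn_cst.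
by rewrite dsin.
Qed.

(** The function p(1/t) exp(-1/t), extended by 0. Letting p vary gives a family which
is closed under differentiation, so smoothness at 0 needs a single first-order
computation. *)
Definition flat (p : {poly R}) (t : R) : R :=
  if 0 < t then p.[t^-1] * expR (- t^-1) else 0.

(** exp(1/t) dominates every power of 1/t; the quadratic bound gives derivative 0
at the origin. *)
Lemma flat_le (p : {poly R}) :
  exists2 C : R, 0 <= C & forall t, `|t| <= 1 -> `|flat p t| <= C * t ^+ 2.
Proof.
pose n := size p; pose S := \sum_(i < n) `|p`_i|.
have S0 : 0 <= S by apply: sumr_ge0 => i _; exact: normr_ge0.
exists (S * (n.+2)`!%:R); first by rewrite mulr_ge0.
move=> t t1; rewrite /flat; case: ltP => [t0|_]; last first.
  by rewrite normr0; apply: mulr_ge0; [exact: mulr_ge0|exact: sqr_ge0].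
have yge1 : 1 <= t^-1 by rewrite invf_ge1// -(gtr0_norm t0).
set y := t^-1 in yge1 *; have y0 : 0 < y := lt_le_trans ltr01 yge1.
have py : `|p.[y]| <= S * y ^+ n.
  rewrite horner_coef mulr_suml (le_trans (ler_norm_sum _ _ _))// ler_sum// => i _.
  rewrite normrM normrX (gtr0_norm y0) ler_wpM2l// ler_weXn2l//.
  exact/ltnW/ltn_ord.
have ey : y ^+ n.+2 / n.+2`!%:R <= expR y.
  by rewrite (le_trans _ (expR_ge1Dxn n.+1 (ltW y0)))// lerDr.
rewrite normrM (gtr0_norm (expR_gt0 _)) expRN.
have -> : t ^+ 2 = y ^- 2 by rewrite /y exprVn invrK.
rewrite ler_pdivrMr ?expR_gt0// (le_trans py)// -!mulrA ler_wpM2l//.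
rewrite -(ler_pM2l (x := (n.+2`!%:R)^-1 * y ^+ 2)); last first.
  by rewrite mulr_gt0 ?exprn_gt0// invr_gt0 ltr0n fact_gt0.
have f0 : n.+2`!%:R != 0 :> R by rewrite pnatr_eq0 -lt0n fact_gt0.
have yn0 : y ^+ 2 != 0 by rewrite expf_neq0// gt_eqF.
rewrite [leRHS](_ : _ = expR y); last by field; rewrite f0 gt_eqF.
by rewrite (le_trans _ ey)// mulrAC -mulrA -exprD mulrC addn2.
Qed.

Definition flat_deriv_poly (p : {poly R}) : {poly R} := 'X^2 * (p - (deriv p)).

Lemma flat_is_derive (p : {poly R}) (t : R) : is_derive t (1 : R) (flat p) (flat (flat_deriv_poly p) t).
Proof.
have [t0|t0|->] := ltgtP t 0.
- have -> : flat (flat_deriv_poly p) t = 0 by rewrite /flat ltNge (ltW t0).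
  apply: (@near_eq_is_derive R R^o R^o (cst (0 : R))).
  near=> s; have s0 : s < 0 by near: s; exact: lt_nbhsl.
  by rewrite /flat ltNge (ltW s0).
- have tn0 : t != 0 by rewrite gt_eqF.
  apply: (@near_eq_is_derive R R^o R^o (fun s => p.[s^-1] * expR (- s^-1))).
    near=> s; have s0 : 0 < s by near: s; exact: lt_nbhsr.
    by rewrite /flat s0.
  have dV : is_derive t 1 (fun s : R => s^-1) (- t ^- 2).
    split; first by apply: derivableV.
    by rewrite deriveV// derive_id /GRing.scale/= mulr1.
  have dh : is_derive t^-1 1 (horner p) (deriv p).[t^-1].
    by split; [exact: derivable_horner|rewrite -derive1E -derivE].
  have dp : is_derive t 1 (horner p \o (fun s : R => s^-1)) ((deriv p).[t^-1] * - t ^- 2).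
    exact: is_derive1_comp.
  have dN : is_derive t 1 (fun s : R => - s^-1) (t ^- 2).
    by apply: is_derive_eq; rewrite opprK.
  have de : is_derive t 1 (expR \o (fun s : R => - s^-1)) (expR (- t^-1) * t ^- 2).
    exact: is_derive1_comp.
  apply: (@is_derive_eq _ _ _ ((horner p \o (fun s : R => s^-1)) *
     (expR \o (fun s : R => - s^-1)))).
  rewrite /flat t0 /flat_deriv_poly hornerM hornerXn hornerD hornerN /GRing.scale/= exprVn.
  by ring.
- have -> : flat (flat_deriv_poly p) 0 = 0 by rewrite /flat ltxx.
  have [C C0 HC] := flat_le p.
  suff H : h^-1 *: (flat p (h *: 1 + 0) - flat p 0) @[h --> 0^'] --> (0 : R).
    by split; [apply/cvg_ex; exists 0|exact: cvg_lim].
  apply/cvgrPdist_le => /= e e0; near=> h.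
  have h0 : h != 0 by near: h; exact: nbhs_dnbhs_neq.
  have hs : `|h| <= Num.min 1 (e / (C + 1)).
    near: h; apply: dnbhs0_le.
    by rewrite lt_min ltr01 divr_gt0// ltr_wpDl.
  move: hs; rewrite le_min => /andP[h1 he].
  rewrite sub0r normrN /GRing.scale/= mulr1 addr0 [X in _ - X]/flat ltxx subr0.
  rewrite normrM normfV (le_trans (ler_wpM2l _ (HC _ h1)))//.
  rewrite -(real_normK (num_real h)).
  have hh : `|h| != 0 by rewrite normr_eq0.
  rewrite [leLHS](_ : _ = C * `|h|); last by field.
  apply: (@le_trans _ _ ((C + 1) * `|h|)); first by rewrite ler_wpM2r// lerDl.
  by rewrite mulrC -ler_pdivlMr// ltr_wpDl.
Unshelve. all: by end_near. Qed.

Lemma smooth1_flat p : smooth1 (flat p).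
Proof.
move=> n; elim: n p => [|n IH] p; (split; first by move=> x; have [] := flat_is_derive p x).
  exact: I.
rewrite (_ : (flat p)^`() = flat (flat_deriv_poly p)); first exact: IH.
by apply/funext => x; rewrite derive1E; have [] := flat_is_derive p x.
Qed.

Let e (t : R) := flat 1 t.

Let e_ge0 t : 0 <= e t.
Proof. by rewrite /e /flat; case: ifP => // _; rewrite hornerE mul1r expR_ge0. Qed.

Let e_gt0 t : 0 < t -> 0 < e t.
Proof. by move=> t0; rewrite /e /flat t0 hornerE mul1r expR_gt0. Qed.

Let e_eq0 t : t <= 0 -> e t = 0.
Proof. by move=> t0; rewrite /e /flat ltNge t0. Qed.

(** The denominator never vanishes: t and 1 - t are not both nonpositive. *)
Definition smooth_step (t : R) : R := flat 1 t / (flat 1 t + flat 1 (1 - t)).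

Let step_den t : 0 < e t + e (1 - t).
Proof.
have [t0|t0] := ltP 0 t; first by rewrite ltr_pwDl ?e_gt0 ?e_ge0.
by rewrite ltr_wpDl ?e_ge0// e_gt0// subr_gt0 (le_lt_trans t0).
Qed.

Lemma smooth1_smooth_step : smooth1 smooth_step.
Proof.
have E : (fun t => e (1 - t)) = (fun t => e (-1 * t + 1)).
  by apply/funext => t; rewrite mulN1r addrC.
apply: (@smooth1M e (fun t => (e t + e (1 - t))^-1)); first exact: smooth1_flat.
apply: smooth1V; first by move=> x; rewrite gt_eqF ?step_den.
apply: (@smooth1D e (fun t => e (1 - t))); first exact: smooth1_flat.
by rewrite E; apply: smooth1_affine; exact: smooth1_flat.
Qed.

Lemma smooth_step_eq0 t : t <= 0 -> smooth_step t = 0.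
Proof. by move=> /e_eq0 t0; rewrite /smooth_step -/(e t) t0 mul0r. Qed.

Lemma smooth_step_eq1 t : 1 <= t -> smooth_step t = 1.
Proof.
move=> t1; rewrite /smooth_step -/(e t) -/(e (1 - t)) [e (1 - t)]e_eq0 ?subr_le0//.
by rewrite addr0 divff// gt_eqF// e_gt0// (lt_le_trans ltr01).
Qed.

Definition bump1 (t : R) : R := smooth_step (2 * t + 2) * smooth_step (- 2 * t + 2).

Lemma smooth1_bump1 : smooth1 bump1.
Proof.
apply: (@smooth1M (fun t => smooth_step (2 * t + 2)) (fun t => smooth_step (- 2 * t + 2)));
  apply: smooth1_affine; exact: smooth1_smooth_step.
Qed.

Lemma bump1_eq1 t : `|t| <= 2^-1 -> bump1 t = 1.
Proof.
by rewrite ler_norml => /andP[? ?]; rewrite /bump1 !smooth_step_eq1 ?mulr1//; lra.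
Qed.

Lemma bump1_eq0 t : 1 <= `|t| -> bump1 t = 0.
Proof.
rewrite ler_normr => /orP[t1|t1]; rewrite /bump1.
  by rewrite [X in _ * X]smooth_step_eq0 ?mulr0//; lra.
by rewrite smooth_step_eq0 ?mul0r//; lra.
Qed.

End OneVariable.

(** * Partial derivatives and jets of complex-valued functions *)

Section ComplexModulus.
Context {R : realType}.
Implicit Types (x y : R[i]) (a b t : R).

Lemma complex_eta x : x = complex.Re x +i* complex.Im x.
Proof. by case: x. Qed.

Lemma ReD x y : complex.Re (x + y) = complex.Re x + complex.Re y.
Proof. by case: x; case: y. Qed.
Lemma ImD x y : complex.Im (x + y) = complex.Im x + complex.Im y.
Proof. by case: x; case: y. Qed.
Lemma ReM x y : complex.Re (x * y) =
  complex.Re x * complex.Re y - complex.Im x * complex.Im y.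
Proof. by case: x; case: y. Qed.
Lemma ImM x y : complex.Im (x * y) =
  complex.Re x * complex.Im y + complex.Im x * complex.Re y.
Proof. by case: x; case: y. Qed.

Lemma cmodM x y : cmod (x * y) = cmod x * cmod y.
Proof. exact: Normc.normcM. Qed.

Lemma cmod_ge0 x : 0 <= cmod x.
Proof. by case: x => a b; exact: sqrtr_ge0. Qed.

Lemma cmod0 : cmod (0 : R[i]) = 0.
Proof. exact: Normc.normc0. Qed.

Lemma cmodN x : cmod (- x) = cmod x.
Proof. by case: x => a b; rewrite /cmod /= !sqrrN. Qed.

Lemma le_cmodD x y : cmod (x + y) <= cmod x + cmod y.
Proof. exact: le_normcD. Qed.

Lemma cmod_le a b : cmod (a +i* b) <= `|a| + `|b|.
Proof.
rewrite /cmod /= -[leRHS]ger0_norm ?addr_ge0// -sqrtr_sqr ler_wsqrtr//.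
rewrite sqrrD !real_normK ?num_real// lerD2r lerDl.
by rewrite mulrn_wge0// mulr_ge0.
Qed.

Lemma cmod_real a : cmod (a%:C) = `|a|.
Proof. by rewrite /cmod /= expr0n /= addr0 sqrtr_sqr. Qed.

Lemma cmod_im a : cmod (0 +i* a) = `|a|.
Proof. by rewrite /cmod /= expr0n /= add0r sqrtr_sqr. Qed.

Lemma cmod_cis t : cmod (cos t +i* sin t) = 1.
Proof. by rewrite /cmod /= cos2Dsin2 sqrtr1. Qed.

Lemma le_cmod_sum (I : Type) (r : seq I) (F : I -> R[i]) :
  cmod (\sum_(i <- r) F i) <= \sum_(i <- r) cmod (F i).
Proof.
elim/big_ind2: _ => [|a b c d ab cd|//]; first by rewrite cmod0.
by rewrite (le_trans (le_cmodD _ _))// lerD.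
Qed.

End ComplexModulus.

Section SmoothCalculus.
Context {R : realType} {d : nat}.
Local Notation V := 'rV[R]_d.
Local Notation fct := (V -> R[i]).
Implicit Types (f g : fct) (k n : nat) (s : seq 'I_d) (x y w : V) (i : 'I_d).

Lemma partialCD i f g x : partiable f x -> partiable g x ->
  partialC i (fun y => f y + g y) x = partialC i f x + partialC i g x.
Proof.
move=> /(_ i)[rf imf] /(_ i)[rg img]; rewrite /partialC.
have -> : (fun y => complex.Re (f y + g y)) =
    (fun y => complex.Re (f y)) + (fun y => complex.Re (g y)).
  by apply/funext => y; rewrite ReD.
have -> : (fun y => complex.Im (f y + g y)) =
    (fun y => complex.Im (f y)) + (fun y => complex.Im (g y)).
  by apply/funext => y; rewrite ImD.
by rewrite (deriveD rf rg) (deriveD imf img).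
Qed.

Lemma partiableD f g x : partiable f x -> partiable g x ->
  partiable (fun y => f y + g y) x.
Proof.
move=> pf pg i; have [rf imf] := pf i; have [rg img] := pg i.
have -> : (fun y => complex.Re (f y + g y)) =
    (fun y => complex.Re (f y)) + (fun y => complex.Re (g y)).
  by apply/funext => y; rewrite ReD.
have -> : (fun y => complex.Im (f y + g y)) =
    (fun y => complex.Im (f y)) + (fun y => complex.Im (g y)).
  by apply/funext => y; rewrite ImD.
by split; [exact: (derivableD rf rg)|exact: (derivableD imf img)].
Qed.

Lemma continuousCD f g x : continuousC_at f x -> continuousC_at g x ->
  continuousC_at (fun y => f y + g y) x.
Proof.
move=> [rf imf] [rg img]; rewrite /continuousC_at.
have -> : (fun y => complex.Re (f y + g y)) =
    (fun y => complex.Re (f y)) + (fun y => complex.Re (g y)).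
  by apply/funext => y; rewrite ReD.
have -> : (fun y => complex.Im (f y + g y)) =
    (fun y => complex.Im (f y)) + (fun y => complex.Im (g y)).
  by apply/funext => y; rewrite ImD.
by split; [exact: (continuousD rf rg)|exact: (continuousD imf img)].
Qed.

Let ReM_fun f g : (fun y => complex.Re (f y * g y)) =
    (fun y => complex.Re (f y)) * (fun y => complex.Re (g y)) -
    (fun y => complex.Im (f y)) * (fun y => complex.Im (g y)).
Proof. by apply/funext => y; rewrite ReM. Qed.

Let ImM_fun f g : (fun y => complex.Im (f y * g y)) =
    (fun y => complex.Re (f y)) * (fun y => complex.Im (g y)) +
    (fun y => complex.Im (f y)) * (fun y => complex.Re (g y)).
Proof. by apply/funext => y; rewrite ImM. Qed.

Lemma partialCM i f g x : partiable f x -> partiable g x ->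
  partialC i (fun y => f y * g y) x = partialC i f x * g x + f x * partialC i g x.
Proof.
move=> /(_ i)[rf imf] /(_ i)[rg img]; rewrite /partialC ReM_fun ImM_fun.
rewrite (deriveB (derivableM rf rg) (derivableM imf img)).
rewrite (deriveD (derivableM rf img) (derivableM imf rg)).
rewrite (deriveM rf rg) (deriveM imf img) (deriveM rf img) (deriveM imf rg).
move: ('D__ (fun y => complex.Re (f y)) x) ('D__ (fun y => complex.Im (f y)) x) => a b.
move: ('D__ (fun y => complex.Re (g y)) x) ('D__ (fun y => complex.Im (g y)) x) => a' b'.
by case: (f x) => u v; case: (g x) => u' v'; rewrite /GRing.scale /=; simpc; congr (_ +i* _); ring.
Qed.

Lemma partiableM f g x : partiable f x -> partiable g x ->
  partiable (fun y => f y * g y) x.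
Proof.
move=> pf pg i; have [rf imf] := pf i; have [rg img] := pg i.
rewrite ReM_fun ImM_fun; split.
  exact: (derivableB (derivableM rf rg) (derivableM imf img)).
exact: (derivableD (derivableM rf img) (derivableM imf rg)).
Qed.

Lemma continuousCM f g x : continuousC_at f x -> continuousC_at g x ->
  continuousC_at (fun y => f y * g y) x.
Proof.
move=> [rf imf] [rg img]; rewrite /continuousC_at ReM_fun ImM_fun; split.
  exact: (continuousB (continuousM rf rg) (continuousM imf img)).
exact: (continuousD (continuousM rf img) (continuousM imf rg)).
Qed.

(** The analogue of [diffn] for partial derivatives; [smoothP] identifies its
conjunction over n with smoothness in terms of all iterated partials. *)
Fixpoint smoothn n f : Prop :=
  (forall x, continuousC_at f x /\ partiable f x) /\
  (if n is m.+1 then forall i, smoothn m (partialC i f) else True).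

Lemma smoothP f : smooth_on setT f <-> forall n, smoothn n f.
Proof.
split=> [sf n|sf s].
  elim: n f sf => [|n IH] f sf; (split; first by move=> x; exact: (sf [::])).
    exact: I.
  move=> i; apply: IH => s x _.
  by rewrite /mpartial -foldr_rcons; exact: sf.
elim/last_ind: s f sf => [|s i IH] f sf x _; first by have [+ _] := sf 0%N; exact.
rewrite /mpartial foldr_rcons; apply: IH => // n.
by have [_] := sf n.+1; exact.
Qed.

Lemma smoothnW n f : smoothn n.+1 f -> smoothn n f.
Proof.
elim: n f => [|n IH] f; first by case=> h _; split.
by move=> [h h']; split=> // i; apply: IH; exact: h'.
Qed.

Lemma smoothnD n f g : smoothn n f -> smoothn n g -> smoothn n (fun x => f x + g x).
Proof.
elim: n f g => [|n IH] f g [hf hf'] [hg hg'].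
  split; last exact: I.
  move=> x; have [cf pf] := hf x; have [cg pg] := hg x.
  by split; [exact: continuousCD|exact: partiableD].
split; first by move=> x; have [cf pf] := hf x; have [cg pg] := hg x;
  split; [exact: continuousCD|exact: partiableD].
move=> i; rewrite (_ : partialC i _ = fun x => partialC i f x + partialC i g x).
  by apply: IH; [exact: hf'|exact: hg'].
by apply/funext => x; apply: partialCD; [have [] := hf x|have [] := hg x].
Qed.

Lemma smoothnM n f g : smoothn n f -> smoothn n g -> smoothn n (fun x => f x * g x).
Proof.
elim: n f g => [|n IH] f g Hf Hg; have [hf hf'] := Hf; have [hg hg'] := Hg.
  split; last exact: I.
  move=> x; have [cf pf] := hf x; have [cg pg] := hg x.
  by split; [exact: continuousCM|exact: partiableM].
split; first by move=> x; have [cf pf] := hf x; have [cg pg] := hg x;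
  split; [exact: continuousCM|exact: partiableM].
move=> i; rewrite (_ : partialC i _ =
    fun x => partialC i f x * g x + f x * partialC i g x).
  apply: smoothnD; apply: IH; [exact: hf'|exact: smoothnW Hg|exact: smoothnW Hf|].
  exact: hg'.
by apply/funext => x; apply: partialCM; [have [] := hf x|have [] := hg x].
Qed.

Lemma partialC_cst i (c : R[i]) : partialC i (fun=> c) = fun=> 0 :> R[i].
Proof. by apply/funext => x; rewrite /partialC !derive_cst. Qed.

Lemma smoothn_cst n (c : R[i]) : smoothn n (fun=> c).
Proof.
elim: n c => [|n IH] c; (split; first by move=> x; split;
  [split; exact: cst_continuous|move=> i; split; exact: derivable_cst]).
  exact: I.
by move=> i; rewrite partialC_cst.
Qed.

Lemma smooth_cst (c : R[i]) : smooth_on setT (fun _ : V => c).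
Proof. by apply/smoothP => n; exact: smoothn_cst. Qed.

Lemma smoothD f g : smooth_on setT f -> smooth_on setT g ->
  smooth_on setT (fun x => f x + g x).
Proof. by move=> /smoothP sf /smoothP sg; apply/smoothP => n; exact: smoothnD. Qed.

Lemma smoothM f g : smooth_on setT f -> smooth_on setT g ->
  smooth_on setT (fun x => f x * g x).
Proof. by move=> /smoothP sf /smoothP sg; apply/smoothP => n; exact: smoothnM. Qed.

Lemma smoothZ (c : R[i]) f : smooth_on setT f -> smooth_on setT (fun x => c * f x).
Proof. by move=> sf; apply: (smoothM _ sf); exact: smooth_cst. Qed.

Lemma smooth_partial i f : smooth_on setT f -> smooth_on setT (partialC i f).
Proof. by move=> sf s x _; rewrite /mpartial -foldr_rcons; exact: sf. Qed.

Lemma smooth_partiable f x : smooth_on setT f -> partiable f x.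
Proof. by move=> /(_ [::] x I)[]. Qed.

Lemma smooth_continuous f : smooth_on setT f ->
  continuous (fun x => complex.Re (f x)) /\ continuous (fun x => complex.Im (f x)).
Proof. by move=> sf; split=> x; have [[]] := sf [::] x I. Qed.

Lemma mpartial_rcons s i f : mpartial (rcons s i) f = mpartial s (partialC i f).
Proof. by rewrite /mpartial foldr_rcons. Qed.

Lemma mpartialD s f g : smooth_on setT f -> smooth_on setT g ->
  mpartial s (fun x => f x + g x) = fun x => mpartial s f x + mpartial s g x.
Proof.
elim/last_ind: s f g => [//|s i IH] f g sf sg.
rewrite !mpartial_rcons
  (_ : partialC i (fun x => f x + g x) = fun x => partialC i f x + partialC i g x).
  exact: (IH _ _ (smooth_partial i sf) (smooth_partial i sg)).
by apply/funext => x; apply: partialCD; exact: smooth_partiable.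
Qed.

(** A pointwise bound on all partials of order at most k. Working pointwise avoids
the suprema of [Cnorm] until the very end, in [Cnorm_le]. *)
Definition jet_le k x f (A : R) := forall s, (size s <= k)%N -> cmod (mpartial s f x) <= A.

Lemma jet_le_ge0 k x f A : jet_le k x f A -> 0 <= A.
Proof. by move=> /(_ [::] isT); apply: le_trans; exact: cmod_ge0. Qed.

(** Each differentiation of a product doubles the number of terms; the factor
2^k is all that is needed of the Leibniz formula. *)
Lemma jet_leM k x f g A B : smooth_on setT f -> smooth_on setT g ->
  jet_le k x f A -> jet_le k x g B -> jet_le k x (fun y => f y * g y) (2 ^+ k * A * B).
Proof.
move=> sf sg fA gB s sk; have A0 := jet_le_ge0 fA; have B0 := jet_le_ge0 gB.
apply: (@le_trans _ _ (2 ^+ size s * A * B)); last first.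
  by rewrite ler_wpM2r// ler_wpM2r// ler_weXn2l// ler1n.
have {fA}fA s' : (size s' <= size s)%N -> cmod (mpartial s' f x) <= A.
  by move=> h; apply: fA; exact: leq_trans sk.
have {gB}gB s' : (size s' <= size s)%N -> cmod (mpartial s' g x) <= B.
  by move=> h; apply: gB; exact: leq_trans sk.
elim/last_ind: s f g sf sg fA gB {sk} => [|s i IH] f g sf sg fA gB.
  by rewrite expr0 mul1r /= cmodM ler_pM ?cmod_ge0//; [exact: (fA [::])|exact: (gB [::])].
have pf := smooth_partial i sf; have pg := smooth_partial i sg.
rewrite mpartial_rcons (_ : partialC i _ =
    fun x => partialC i f x * g x + f x * partialC i g x); last first.
  by apply/funext => y; apply: partialCM; exact: smooth_partiable.
rewrite (mpartialD _ (smoothM pf sg) (smoothM sf pg)).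
rewrite (le_trans (le_cmodD _ _))// size_rcons exprS -!mulrA mulr_natl mulr2n.
rewrite !mulrA lerD// IH// => s' s's.
- by rewrite -mpartial_rcons fA// !size_rcons.
- by apply: gB; rewrite size_rcons ltnW.
- by apply: fA; rewrite size_rcons ltnW.
- by rewrite -mpartial_rcons gB// !size_rcons.
Qed.

Lemma jet_le_exists k (K : set V) f : compact K -> smooth_on setT f ->
  exists A : R, forall x, K x -> jet_le k x f A.
Proof.
move=> cK; elim: k f => [|k IH] f sf.
  have [cr ci] := smooth_continuous sf.
  have bnd (h : V -> R) : continuous h -> exists M, forall x, K x -> `|h x| <= M.
    move=> ch; have /compact_bounded[M [_ hM]] :
      compact (h @` K) by apply: continuous_compact => //; exact: continuous_subspaceT.
    by exists (M + 1) => x Kx; apply: (hM (M + 1)); [rewrite ltrDl|exists x].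
  have [M1 H1] := bnd _ cr; have [M2 H2] := bnd _ ci.
  exists (M1 + M2) => x Kx s; rewrite leqn0 size_eq0 => /eqP ->.
  rewrite /= [f x]complex_eta (le_trans (cmod_le _ _))// lerD//; [exact: H1|exact: H2].
have [A0 HA0] := IH f sf.
have [A HA] := fin_all_exists (fun i => IH (partialC i f) (smooth_partial i sf)).
exists (`|A0| + \sum_i `|A i|) => x Kx s.
case/lastP: s => [|s i].
  move=> _; apply: (le_trans (HA0 x Kx [::] isT)); rewrite (le_trans (ler_norm _))//.
  by rewrite lerDl sumr_ge0.
rewrite size_rcons ltnS mpartial_rcons => /(HA i x Kx) h.
apply: (le_trans h); rewrite (le_trans (ler_norm _))// (bigD1 i)//= addrCA lerDl.
by rewrite addr_ge0// sumr_ge0.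
Qed.

(** Nonnegativity is included because the continuity constant of a distribution
is an arbitrary real, so both bounds are needed to pass to its absolute
value. *)
Lemma Cnorm_le (K : set V) k f (A : R) : 0 <= A ->
  (forall x, K x -> jet_le k x f A) -> 0 <= Cnorm K k f <= A.
Proof.
move=> A0 H; rewrite /Cnorm; set S := [set y | _].
have ubS : ubound S A by move=> _ [s [x [sk Kx ->]]]; exact: H.
have [->|/set0P[y Sy]] := eqVneq S set0; first by rewrite sup0 lexx.
apply/andP; split; last by apply: ge_sup => //; exists y.
apply: (@le_trans _ _ y); last by apply: ub_le_sup => //; exists A.
by case: Sy => s [x [_ _ ->]]; exact: cmod_ge0.
Qed.

End SmoothCalculus.

(** * Ridge functions, exponentials and bumps *)

Section Ridge.
Context {R : realType} {d : nat}.
Local Notation V := 'rV[R]_d.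
Local Notation fct := (V -> R[i]).
Implicit Types (f phi psi : fct) (g : R -> R) (k n : nat) (s : seq 'I_d) (x y w : V) (i : 'I_d).

Lemma dotvDl x y w : dotv (x + y) w = dotv x w + dotv y w.
Proof. by rewrite /dotv -big_split; apply: eq_bigr => i _; rewrite mxE mulrDl. Qed.

Lemma dotvZl (a : R) x w : dotv (a *: x) w = a * dotv x w.
Proof. by rewrite /dotv mulr_sumr; apply: eq_bigr => i _; rewrite mxE mulrA. Qed.

Lemma dotvC x w : dotv x w = dotv w x.
Proof. by apply: eq_bigr => i _; rewrite mulrC. Qed.

Lemma dotv_delta x i : dotv x (delta_mx 0 i) = x 0 i.
Proof.
rewrite /dotv (bigD1 i)//= mxE !eqxx mulr1 big1 ?addr0// => j ji.
by rewrite mxE (negbTE ji) andbF mulr0.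
Qed.

Lemma dotv_continuous w : continuous (fun x => dotv x w).
Proof.
apply: (@continuous_big R 'I_d +%R 0 xpredT _ V) => [|i _]; first exact: add_continuous.
move=> x; apply: (@continuousM _ V (fun x => x 0 i) (fun=> w 0 i)).
  exact: coord_continuous.
exact: cst_continuous.
Qed.

Lemma le_coord_norm x i : `|x 0 i| <= `|x|.
Proof.
rewrite [leRHS]/Num.Def.normr /= mx_normrE.
exact: (le_bigmax _ (fun ij : 'I_1 * 'I_d => `|x ij.1 ij.2|) (0, i)).
Qed.

Lemma norm_le_coord x (a : R) : 0 <= a -> (forall i, `|x 0 i| <= a) -> `|x| <= a.
Proof.
move=> a0 H; rewrite /Num.Def.normr /= mx_normrE; apply: bigmax_le => // -[j i] _.
by rewrite ord1; exact: H.
Qed.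

Lemma derive_dotv g w i x : derivable g (dotv x w) 1 ->
  derivable (fun y => g (dotv y w)) x (delta_mx 0 i) /\
  'D_(delta_mx 0 i) (fun y => g (dotv y w)) x = w 0 i * derive1 g (dotv x w).
Proof.
move=> dg.
pose a (h : R) := w 0 i * h + dotv x w.
have E : (fun h : R => g (dotv (h *: delta_mx 0 i + x) w)) = g \o a.
  by apply/funext => h; rewrite /a /= dotvDl dotvZl (dotvC (delta_mx _ _)) dotv_delta mulrC.
have a0 : a 0 = dotv x w by rewrite /a mulr0 add0r.
have da := is_derive_affine (w 0 i) (dotv x w) 0.
have da0 : derivable a 0 1 by case: da.
have dga0 : derivable g (a 0) 1 by rewrite a0.
have dga : derivable (g \o a) 0 1.
  apply/derivable1_diffP; apply: differentiable_comp; exact/derivable1_diffP.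
split; first by apply/derivable1P; rewrite E.
have -> : 'D_(delta_mx 0 i) (fun y => g (dotv y w)) x = 'D_1 (g \o a) 0.
  rewrite /derive; congr (lim (_ @ 0^')); apply/funext => h.
  by rewrite -E /= addr0 [h%:A]mulr1 scale0r add0r.
rewrite -derive1E (derive1_comp da0 dga0) a0 mulrC; congr (_ * _).
by rewrite derive1E; apply: derive_val.
Qed.

(** Coordinate functions (w a basis vector) and plane waves (w a frequency) are both of
this form, so one computation of partials, [mpartial_ridge], covers them. *)
Definition ridge (g1 g2 : R -> R) w : fct :=
  fun x => g1 (dotv x w) +i* g2 (dotv x w).

Lemma partialC_ridge g1 g2 w i : smooth1 g1 -> smooth1 g2 ->
  partialC i (ridge g1 g2 w) =
  fun x => (w 0 i)%:C * ridge (derive1 g1) (derive1 g2) w x.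
Proof.
move=> s1 s2; apply/funext => x; rewrite /partialC /ridge /=.
rewrite (derive_dotv i (smooth1_derivable s1 (x := dotv x w))).2.
rewrite (derive_dotv i (smooth1_derivable s2 (x := dotv x w))).2.
by simpc.
Qed.

Lemma smooth_ridge g1 g2 w : smooth1 g1 -> smooth1 g2 -> smooth_on setT (ridge g1 g2 w).
Proof.
have base h1 h2 x : smooth1 h1 -> smooth1 h2 ->
    continuousC_at (ridge h1 h2 w) x /\ partiable (ridge h1 h2 w) x.
  move=> s1 s2; split.
    split; apply: continuous_comp; try exact: dotv_continuous.
      exact: (smooth1_continuous s1).
    exact: (smooth1_continuous s2).
  move=> i; split.
    exact: (derive_dotv i (smooth1_derivable s1 (x := dotv x w))).1.
  exact: (derive_dotv i (smooth1_derivable s2 (x := dotv x w))).1.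
move=> s1 s2; apply/smoothP => n; elim: n g1 g2 s1 s2 => [|n IH] g1 g2 s1 s2.
  by split; [move=> x; exact: base|exact: I].
split; first by move=> x; exact: base.
move=> i; rewrite (partialC_ridge w i s1 s2); apply: smoothnM; first exact: smoothn_cst.
by apply: IH; exact: smooth1_deriv.
Qed.

Lemma mpartialZ s (c : R[i]) f : smooth_on setT f ->
  mpartial s (fun x => c * f x) = fun x => c * mpartial s f x.
Proof.
elim/last_ind: s f => [//|s i IH] f sf; rewrite !mpartial_rcons.
rewrite -(IH _ (smooth_partial i sf)); congr mpartial; apply/funext => x.
rewrite partialCM; last exact: smooth_partiable.
  by rewrite partialC_cst mul0r add0r.
by apply: smooth_partiable; exact: smooth_cst.
Qed.

Lemma mpartial_ridge s g1 g2 w : smooth1 g1 -> smooth1 g2 ->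
  mpartial s (ridge g1 g2 w) =
  fun x => (\prod_(i <- s) (w 0 i)%:C) * ridge (derive1n (size s) g1) (derive1n (size s) g2) w x.
Proof.
elim/last_ind: s g1 g2 => [|s i IH] g1 g2 s1 s2.
  by apply/funext => x; rewrite big_nil mul1r.
rewrite mpartial_rcons (partialC_ridge w i s1 s2) mpartialZ; last first.
  by apply: smooth_ridge; exact: smooth1_deriv.
rewrite IH; [|exact: smooth1_deriv..]; apply/funext => x.
by rewrite size_rcons !derive1Sn -cats1 big_cat big_seq1 mulrA [in LHS](mulrC (_%:C)).
Qed.

(** The partials of a function of one coordinate are its derivatives or zero, so
C^k approximation on the line transfers to the space with the same error. *)
Lemma jet_le_ridge_coord k g i x (A : R) : smooth1 g ->
  (forall j, (j <= k)%N -> `|derive1n j g (x 0 i)| <= A) ->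
  jet_le k x (ridge g (cst 0) (delta_mx 0 i)) A.
Proof.
move=> sg H s sk; rewrite mpartial_ridge//; last exact: smooth1_cst.
have d0 n : derive1n n (cst (0 : R)) = cst 0.
  elim: n => [//|n IHn]; rewrite derive1Sn (_ : derive1 _ = cst 0)//.
  by apply/funext => y; rewrite derive1_cst.
rewrite cmodM /ridge d0 dotv_delta -/(real_complex R _) cmod_real.
apply: (@le_trans _ _ (1 * A)); last by rewrite mul1r.
apply: ler_pM; [exact: cmod_ge0|exact: normr_ge0| |exact: H].
elim: s {sk} => [|j s IHs]; first by rewrite big_nil cmod_real normr1.
rewrite big_cons cmodM cmod_real mxE eqxx /=.
by rewrite mulr_ile1 ?cmod_ge0//; case: eqP => _; rewrite ?normr0 ?normr1.
Qed.

Lemma fourier_expE (xi : V) : fourier_exp xi =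
  ridge (fun t => cos (- (2 * pi) * t + 0)) (fun t => sin (- (2 * pi) * t + 0)) xi.
Proof. by apply/funext => x; rewrite /fourier_exp /ridge addr0 mulNr. Qed.

Lemma smooth_fourier_exp (xi : V) : smooth_on setT (fourier_exp xi).
Proof.
have [c s] := @smooth1_trig R.
by rewrite fourier_expE; apply: smooth_ridge; exact: smooth1_affine.
Qed.

Lemma fourier_expD (xi eta : V) x :
  fourier_exp (xi + eta) x = fourier_exp xi x * fourier_exp eta x.
Proof.
rewrite /fourier_exp (dotvC x) dotvDl !(dotvC _ x) mulrDr opprD cosD sinD; simpc.
by congr (_ +i* _); rewrite addrC.
Qed.

Lemma partialC_fourier_exp (xi : V) i : partialC i (fourier_exp xi) =
  fun x => (0 +i* - (2 * pi * xi 0 i)) * fourier_exp xi x.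
Proof.
have [c s] := @smooth1_trig R.
rewrite [in LHS]fourier_expE partialC_ridge; try exact: smooth1_affine.
apply/funext => x; rewrite /ridge.
have aff := is_derive_affine (- (2 * pi : R)) 0.
have -> : derive1 (fun t : R => cos (- (2 * pi) * t + 0)) (dotv x xi) =
    - sin (- (2 * pi) * dotv x xi + 0) * - (2 * pi).
  by rewrite derive1E; apply: derive_val.
have -> : derive1 (fun t : R => sin (- (2 * pi) * t + 0)) (dotv x xi) =
    cos (- (2 * pi) * dotv x xi + 0) * - (2 * pi).
  by rewrite derive1E; apply: derive_val.
rewrite /fourier_exp addr0 -mulNr; simpc.
by congr (_ +i* _); ring.
Qed.

Lemma cmod_mpartial_fourier_exp (xi : V) s x :
  cmod (mpartial s (fourier_exp xi) x) <= (2 * pi * `|xi|) ^+ size s.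
Proof.
have [c E] : exists2 c, mpartial s (fourier_exp xi) = (fun x => c * fourier_exp xi x) &
    cmod c <= (2 * pi * `|xi|) ^+ size s; last first.
  by move=> cle; rewrite E cmodM cmod_cis mulr1.
elim/last_ind: s => [|s i [c E cle]].
  by exists 1; [apply/funext => y; rewrite mul1r|rewrite cmod_real normr1].
exists ((0 +i* - (2 * pi * xi 0 i)) * c).
  rewrite mpartial_rcons partialC_fourier_exp mpartialZ; last exact: smooth_fourier_exp.
  by rewrite E; apply/funext => y; rewrite mulrA.
rewrite cmodM cmod_im normrN size_rcons exprS ler_pM ?cmod_ge0//.
by rewrite !normrM ger0_norm// (ger0_norm (pi_ge0 _)) ler_wpM2l ?mulr_ge0 ?pi_ge0// le_coord_norm.
Qed.

Lemma jet_le_fourier_exp (xi : V) k x :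
  jet_le k x (fourier_exp xi) ((1 + 2 * pi * `|xi|) ^+ k).
Proof.
move=> s sk; have p0 : 0 <= 2 * pi * `|xi| by rewrite !mulr_ge0 ?pi_ge0.
apply: (le_trans (cmod_mpartial_fourier_exp xi s x)).
rewrite (le_trans (_ : _ <= (1 + 2 * pi * `|xi|) ^+ size s))//.
  by rewrite lerXn2r// ?nnegrE ?addr_ge0// lerDr.
by rewrite ler_weXn2l// lerDl.
Qed.

Definition coord_bump (x0 : V) (r : R) i : fct :=
  ridge (fun t => bump1 (r^-1 * t + - (r^-1 * x0 0 i))) (cst 0) (delta_mx 0 i).

Lemma coord_bumpE x0 r i x : coord_bump x0 r i x = (bump1 (r^-1 * (x 0 i - x0 0 i)))%:C.
Proof. by rewrite /coord_bump /ridge dotv_delta mulrBr. Qed.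

(** The product over a list of coordinates, rather than over all of them, allows
multiplying a distribution by the full bump one coordinate at a time. *)
Definition bump_over s (x0 : V) (r : R) : fct := fun x => \prod_(i <- s) coord_bump x0 r i x.

Definition bump x0 r : fct := bump_over (enum 'I_d) x0 r.

Lemma smooth_bump_over s x0 r : smooth_on setT (bump_over s x0 r).
Proof.
elim: s => [|i s IH]; rewrite /bump_over.
  by under eq_fun do rewrite big_nil; exact: smooth_cst.
under eq_fun do rewrite big_cons; apply: (smoothM _ IH); apply: smooth_ridge.
  by apply: smooth1_affine; exact: smooth1_bump1.
exact: smooth1_cst.
Qed.

Lemma bump_eq1 x0 r x : 0 < r -> `|x - x0| <= r / 2 -> bump x0 r x = 1.
Proof.
move=> r0 xr; rewrite /bump /bump_over big1// => i _; rewrite coord_bumpE bump1_eq1//.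
rewrite normrM gtr0_norm ?invr_gt0// mulrC ler_pdivrMr// mulrC.
by have := le_coord_norm (x - x0) i; rewrite !mxE => /le_trans; apply.
Qed.

Lemma bump_eq0 x0 r x : 0 < r -> r < `|x - x0| -> bump x0 r x = 0.
Proof.
move=> r0 xr.
have [i hi] : exists i, r < `|(x - x0) 0 i|.
  apply/not_existsP => H; move: xr; rewrite ltNge => /negP; apply.
  by apply: norm_le_coord; [exact: ltW|move=> i; rewrite leNgt; apply/negP; exact: H].
rewrite /bump /bump_over (big_rem i) ?mem_enum//= coord_bumpE bump1_eq0 ?mul0r//.
by rewrite normrM gtr0_norm ?invr_gt0// mulrC ler_pdivlMr// mul1r; move: hi; rewrite !mxE => /ltW.
Qed.

Lemma compact_cball (x0 : V) (r : R) : compact [set x | `|x - x0| <= r].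
Proof.
apply: bounded_closed_compact.
  exists (r + `|x0|); split; first exact: num_real.
  move=> M hM x /= xr; rewrite -(subrK x0 x) (le_trans (ler_normD _ _))//.
  by rewrite (le_trans _ (ltW hM))// lerD2r.
apply: (@closed_comp _ _ (fun x => `|x - x0|) [set y | y <= r]); last exact: closed_le.
move=> x _; apply: (@continuous_comp _ _ _ (fun x => x - x0) (fun y => `|y|)).
  by apply: continuousB; [exact: cvg_id|exact: cst_continuous].
exact: norm_continuous.
Qed.

Lemma test_fun_bump (U : set V) x0 r : 0 < r -> [set x | `|x - x0| <= r] `<=` U ->
  test_fun U (bump x0 r).
Proof.
move=> r0 rU; split; first exact: smooth_bump_over.
exists [set x | `|x - x0| <= r]; split => //; first exact: compact_cball.
by move=> x /negP; rewrite -ltNge; exact: bump_eq0.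
Qed.

Lemma open_cball (U : set V) x0 : open U -> U x0 ->
  exists2 r : R, 0 < r & [set x | `|x - x0| <= r] `<=` U.
Proof.
move=> oU Ux0; have /nbhs_ballP[e /= e0 eU] : nbhs x0 U by exact: open_nbhs_nbhs.
exists (e / 2); first by rewrite divr_gt0.
move=> x /= xe; apply: eU; rewrite -ball_normE /= distrC (le_lt_trans xe)//.
by rewrite ltr_pdivrMr// mulr_natr mulr2n ltrDl.
Qed.

End Ridge.

(** * Supports, cutoffs and the pairing of compactly supported distributions *)

Section Localization.
Context {R : realType} {d : nat}.
Local Notation V := 'rV[R]_d.
Local Notation fct := (V -> R[i]).
Implicit Types (f phi psi chi : fct) (u v : fct -> R[i]) (U W K : set V) (x y : V).

Lemma test_funS U W phi : U `<=` W -> test_fun U phi -> test_fun W phi.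
Proof.
move=> UW [sphi [K [cK KU Kphi]]]; split=> //; exists K; split=> //.
exact: subset_trans UW.
Qed.

Lemma test_funM U f phi : smooth_on setT f -> test_fun U phi ->
  test_fun U (fun x => f x * phi x).
Proof.
move=> sf [sphi [K [cK KU Kphi]]]; split; first exact: (smoothM sf sphi).
by exists K; split=> // x nKx; rewrite Kphi// mulr0.
Qed.

Lemma test_funD U phi psi : test_fun U phi -> test_fun U psi ->
  test_fun U (fun x => phi x + psi x).
Proof.
move=> [sphi [K [cK KU Kphi]]] [spsi [L [cL LU Lpsi]]].
split; first exact: (smoothD sphi spsi).
exists (K `|` L); split; first exact: compactU.
  by rewrite subUset.
by move=> x /not_orP[nK nL]; rewrite Kphi// Lpsi// addr0.
Qed.

Lemma test_fun0 U : test_fun U (fun=> 0).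
Proof.
by split; [exact: smooth_cst|exists set0; split => //; exact: compact0].
Qed.

(** The functionals for which supports localize: if u is one of them, so is phi u, by
[linear_test_mul]. *)
Definition linear_test U u := forall (a : R[i]) phi psi,
  test_fun U phi -> test_fun U psi ->
  u (fun x => a * phi x + psi x) = a * u phi + u psi.

Section Linear.
Variables (U : set V) (u : fct -> R[i]).
Hypothesis lu : linear_test U u.

Lemma linear_test0 : u (fun=> 0) = 0.
Proof.
have := lu 1 (test_fun0 U) (test_fun0 U).
rewrite (_ : (fun _ => _) = fun=> 0); last by apply/funext => x; rewrite mulr0 addr0.
by rewrite mul1r -{1}[u _]addr0 => /addrI.
Qed.

Lemma linear_testZ (a : R[i]) phi : test_fun U phi -> u (fun x => a * phi x) = a * u phi.
Proof.
move=> tphi; have := lu a tphi (test_fun0 U).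
rewrite linear_test0 addr0 => <-; congr u; apply/funext => x; by rewrite addr0.
Qed.

Lemma linear_testD phi psi : test_fun U phi -> test_fun U psi ->
  u (fun x => phi x + psi x) = u phi + u psi.
Proof.
move=> tphi tpsi; have := lu 1 tphi tpsi.
by rewrite mul1r => <-; congr u; apply/funext => x; rewrite mul1r.
Qed.

Lemma linear_testB phi psi : test_fun U phi -> test_fun U psi ->
  u (fun x => phi x - psi x) = u phi - u psi.
Proof.
move=> tphi tpsi; have := lu (-1) tpsi tphi.
rewrite mulN1r addrC => <-; congr u; apply/funext => x.
by rewrite mulN1r addrC.
Qed.

Lemma linear_test_sum (J : Type) (r : seq J) (F : J -> fct) :
  (forall j, test_fun U (F j)) ->
  u (fun x => \sum_(j <- r) F j x) = \sum_(j <- r) u (F j).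
Proof.
move=> tF.
suff [] : test_fun U (fun x => \sum_(j <- r) F j x) /\
  u (fun x => \sum_(j <- r) F j x) = \sum_(j <- r) u (F j) by [].
elim: r => [|j r [tr IH]].
  under eq_fun do rewrite big_nil.
  by rewrite big_nil linear_test0; split => //; exact: test_fun0.
under eq_fun do rewrite big_cons.
rewrite big_cons -IH (linear_testD (tF j) tr).
by split; first exact: (test_funD (tF j) tr).
Qed.

End Linear.

Lemma finite_ball_cover K (r : V -> R) : compact K -> (forall x, 0 < r x) ->
  exists l : seq V, (forall x, x \in l -> K x) /\
    (forall y, K y -> exists2 x, x \in l & `|y - x| < r x / 2).
Proof.
move=> cK r0; have : cover_compact K by rewrite -compact_cover.
move=> /(_ V K (fun x => ball x (r x / 2))).
case=> [x _|x Kx|D DK KD]; first exact: ball_open.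
  by exists x => //; apply: ballxx; rewrite divr_gt0.
exists (finmap.enum_fset D); split=> [x xD|y /KD[x /= xD xy]]; first by have := DK _ xD; rewrite inE.
by exists x => //; move: xy; rewrite -ball_normE /= distrC.
Qed.

(** Multiplying psi by the product of the 1 - bump over a finite cover of its
support gives 0, while removing the bumps one by one does not change the value of
u, since each removed piece is supported in a set where psi is killed. *)
Lemma linear_test_local U u psi : linear_test U u -> test_fun U psi ->
  (forall x, U x -> exists W, [/\ open W, W x, W `<=` U &
    forall theta, test_fun W theta -> u (fun y => theta y * psi y) = 0]) ->
  u psi = 0.
Proof.
move=> lu tpsi loc; have [spsi [K [cK KU Kpsi]]] := tpsi.
have /choice[r Hr] x : exists r : R, 0 < r /\ (K x -> forall f, smooth_on setT f ->
    u (fun y => f y * bump x r y * psi y) = 0).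
  have [Kx|nKx] := pselect (K x); last by exists 1; split.
  have [W [oW Wx WU HW]] := loc x (KU x Kx).
  have [r r0 rW] := open_cball oW Wx; exists r; split => // _ f sf.
  apply: HW; apply: (test_funM sf); exact: test_fun_bump.
have r0 x := (Hr x).1.
have [l [lK Kl]] := finite_ball_cover cK r0.
pose P (l : seq V) y : R[i] := \prod_(x <- l) (1 - bump x (r x) y).
have sP s : smooth_on setT (P s).
  elim: s => [|x s IH]; rewrite /P.
    by under eq_fun do rewrite big_nil; exact: smooth_cst.
  under eq_fun do rewrite big_cons; apply: (smoothM _ IH).
  have -> : (fun y => 1 - bump x (r x) y) = (fun y => 1 + -1 * bump x (r x) y).
    by apply/funext => y; rewrite mulN1r.
  by apply: smoothD; [exact: smooth_cst|apply: smoothZ; exact: smooth_bump_over].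
have step s : (forall x, x \in s -> K x) -> u (fun y => P s y * psi y) = u psi.
  elim: s => [_|x s IH sK].
    by congr u; apply/funext => y; rewrite /P big_nil mul1r.
  rewrite -IH; last by move=> y ys; apply: sK; rewrite inE ys orbT.
  transitivity (u (fun y => P s y * psi y - P s y * bump x (r x) y * psi y)).
    by congr u; apply/funext => y; rewrite /P big_cons; ring.
  rewrite (linear_testB lu); [|exact: (test_funM (sP s) tpsi)|].
    by rewrite ((Hr x).2 _ _ (sP s)) ?subr0//; apply: sK; rewrite inE eqxx.
  by apply: (test_funM _ tpsi); apply: smoothM; [exact: sP|exact: smooth_bump_over].
rewrite -(step l lK) (_ : (fun y => _) = fun=> 0); first exact: linear_test0 lu.
apply/funext => y; have [Ky|nKy] := pselect (K y); last by rewrite Kpsi// mulr0.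
have [x xl yx] := Kl y Ky; rewrite /P (big_rem x)//= bump_eq1//; last exact: ltW.
by rewrite subrr !mul0r.
Qed.

(** The complement to 1 of a product of 1 - bump is 1 wherever one of the bumps
is; this replaces a partition of unity without any division. *)
Lemma cutoff_exists U K : open U -> compact K -> K `<=` U -> exists chi, is_cutoff U K chi.
Proof.
move=> oU cK KU.
have /choice[r Hr] x : exists r : R, 0 < r /\ (K x -> [set y | `|y - x| <= r] `<=` U).
  have [Kx|nKx] := pselect (K x); last by exists 1; split.
  by have [r r0 rU] := open_cball oU (KU x Kx); exists r.
have r0 x := (Hr x).1.
have [l [lK Kl]] := finite_ball_cover cK r0.
exists (fun y => 1 - \prod_(x <- l) (1 - bump x (r x) y)); split.
  elim: l lK {Kl} => [_|x s IH sK].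
    by under eq_fun do rewrite big_nil subrr; exact: test_fun0.
  have ts : test_fun U (fun y => 1 - \prod_(x <- s) (1 - bump x (r x) y)).
    by apply: IH => y ys; apply: sK; rewrite inE ys orbT.
  have tb : test_fun U (bump x (r x)).
    by apply: test_fun_bump => //; apply: (Hr x).2; apply: sK; rewrite inE eqxx.
  under eq_fun do rewrite big_cons.
  rewrite (_ : (fun y => _) = fun y => bump x (r x) y +
     (1 + -1 * bump x (r x) y) * (1 - \prod_(x <- s) (1 - bump x (r x) y))); last first.
    by apply/funext => y; ring.
  apply: (test_funD tb); apply: (test_funM _ ts); apply: smoothD; first exact: smooth_cst.
  by apply: smoothZ; exact: smooth_bump_over.
exists (\bigcup_(x in [set` l]) ball x (r x / 2)); split.
- by apply: bigcup_open => x _; exact: ball_open.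
- by move=> y /Kl[x xl xy]; exists x => //; rewrite -ball_normE /= distrC.
- move=> y [x /= xl]; rewrite -ball_normE /= distrC => xy.
  by rewrite (big_rem x)//= bump_eq1 ?ltW// subrr mul0r subr0.
Qed.

Lemma is_cutoffS U K L chi : L `<=` K -> is_cutoff U K chi -> is_cutoff U L chi.
Proof.
by move=> LK [tchi [W [oW KW W1]]]; split=> //; exists W; split=> //; exact: subset_trans KW.
Qed.

Lemma linear_test_off_support U v psi W : open U -> linear_test U v -> test_fun U psi ->
  open W -> dist_support U v `<=` W -> (forall x, W x -> psi x = 0) -> v psi = 0.
Proof.
move=> oU lv tpsi oW vW W0; apply: (linear_test_local lv tpsi) => x Ux.
(* Near the support psi vanishes; off the support v vanishes locally. *)
have [Sx|nSx] := pselect (dist_support U v x).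
  exists (W `&` U); split; [exact: openI|by split; [exact: vW|]|by move=> y []|].
  move=> theta [_ [K [_ KWU Ktheta]]].
  rewrite (_ : (fun y => _) = fun=> 0); first exact: linear_test0 lv.
  apply/funext => y; have [/KWU[Wy _]|/Ktheta ->] := pselect (K y).
    by rewrite W0// mulr0.
  by rewrite mul0r.
have [W' [oW' W'x W'U vW']] : exists W', [/\ open W', W' x, W' `<=` U &
    dist_eq_on W' v (fun=> 0)] by apply: contrapT => h; exact: nSx.
exists W'; split=> // theta ttheta; apply: vW'.
rewrite (_ : (fun y => _) = fun y => psi y * theta y); last first.
  by apply/funext => y; rewrite mulrC.
by apply: (test_funM _ ttheta); case: tpsi.
Qed.

(** Two cutoffs differ by a function which vanishes near the support. *)
Lemma cpairE U v chi psi : open U -> linear_test U v ->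
  is_cutoff U (dist_support U v) chi -> smooth_on setT psi ->
  cpair U v psi = v (fun x => chi x * psi x).
Proof.
move=> oU lv cchi spsi; rewrite /cpair.
set chi0 := xget _ _.
have [t0 [W0 [oW0 vW0 W01]]] : is_cutoff U (dist_support U v) chi0.
  exact: (xgetPex (fun=> 0) (ex_intro _ chi cchi)).
have [t1 [W1 [oW1 vW1 W11]]] := cchi.
have tM phi : test_fun U phi -> test_fun U (fun x => phi x * psi x).
  move=> tphi; rewrite (_ : (fun x => _) = fun x => psi x * phi x).
    exact: test_funM.
  by apply/funext => x; rewrite mulrC.
apply/eqP; rewrite -subr_eq0 -(linear_testB lv (tM _ t0) (tM _ t1)); apply/eqP.
apply: (@linear_test_off_support U v _ (W0 `&` W1) oU lv).
- rewrite (_ : (fun x => _) = fun x => chi0 x * psi x + -1 * (chi x * psi x)).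
    apply: test_funD; first exact: tM.
    by apply: test_funM; [exact: smooth_cst|exact: tM].
  by apply/funext => x; rewrite mulN1r.
- exact: openI.
- by move=> x Sx; split; [exact: vW0|exact: vW1].
- by move=> x [W0x W1x]; rewrite W01// W11// subrr.
Qed.

Lemma schwartz_linear U u : schwartz_distr U u -> linear_test U u.
Proof. by case. Qed.

Lemma schwartz_bound U u K : schwartz_distr U u -> compact K -> K `<=` U ->
  exists (C : R) (k : nat), 0 <= C /\ forall f A, smooth_on setT f -> supported_in K f ->
    0 <= A -> (forall x, K x -> jet_le k x f A) -> cmod (u f) <= C * A.
Proof.
move=> [_ /(_ K)] H cK KU; have [C [k HC]] := H cK KU.
exists `|C|, k; split=> // f A sf Kf A0 fA; apply: (le_trans (HC f sf Kf)).
have /andP[N0 NA] := Cnorm_le A0 fA.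
apply: (le_trans (ler_norm _)); rewrite normrM (ger0_norm N0).
by rewrite ler_wpM2l.
Qed.

Lemma linear_test_mul U u phi : linear_test U u -> smooth_on setT phi ->
  linear_test U (dist_mul phi u).
Proof.
move=> lu sphi a f g tf tg; rewrite /dist_mul -lu; [|exact: test_funM..].
by congr u; apply/funext => x; rewrite mulrDr mulrCA.
Qed.

Lemma dist_support_mul U u phi K : open U -> linear_test U u -> compact K ->
  supported_in K phi -> dist_support U (dist_mul phi u) `<=` K.
Proof.
move=> oU lu cK Kphi x [Ux nx]; apply: contrapT => nKx; apply: nx.
exists (U `&` ~` K); split; [|by split|exact: subIsetl|].
  by apply: openI => //; apply: closed_openC; apply: compact_closed => //; exact: norm_hausdorff.
move=> psi [_ [L [_ LU Lpsi]]]; rewrite /dist_mul.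
rewrite (_ : (fun y => _) = fun=> 0); first exact: linear_test0 lu.
apply/funext => y; have [/LU[_ nKy]|/Lpsi ->] := pselect (L y); last by rewrite mulr0.
by rewrite Kphi// mul0r.
Qed.

(** The support of phi u lies in that of phi, and a cutoff equal to 1 there is
absorbed by phi. *)
Lemma cfourier_mul U u phi (xi : V) : open U -> linear_test U u -> test_fun U phi ->
  cfourier U (dist_mul phi u) xi = u (fun x => phi x * fourier_exp xi x).
Proof.
move=> oU lu [sphi [K [cK KU Kphi]]].
have [chi cchi] := cutoff_exists oU cK KU.
have cchi' := is_cutoffS (dist_support_mul oU lu cK Kphi) cchi.
rewrite /cfourier (cpairE oU (linear_test_mul lu sphi) cchi' (smooth_fourier_exp xi)).
rewrite /dist_mul; congr u; apply/funext => x.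
have [Kx|nKx] := pselect (K x); last by rewrite Kphi// !mul0r.
by have [_ [W [_ KW ->]]] := cchi; [rewrite mul1r|exact: KW].
Qed.

Lemma compact_distr_cutoff U v : open U -> compact_distr U v ->
  exists chi, is_cutoff U (dist_support U v) chi.
Proof. by move=> oU [_ cv]; apply: cutoff_exists => // x []. Qed.

Lemma cutoff_mul_test U v chi phi : open U -> linear_test U v ->
  is_cutoff U (dist_support U v) chi -> test_fun U phi ->
  v (fun x => chi x * phi x) = v phi.
Proof.
move=> oU lv [[schi tchi] [W [oW vW W1]]] tphi.
have tcp : test_fun U (fun x => chi x * phi x) by exact: test_funM.
apply/eqP; rewrite -subr_eq0 -(linear_testB lv tcp tphi); apply/eqP.
apply: (@linear_test_off_support U v _ W oU lv _ oW vW).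
- rewrite (_ : (fun x => _) = fun x => chi x * phi x + -1 * phi x).
    by apply: (test_funD tcp); apply: (test_funM _ tphi); exact: smooth_cst.
  by apply/funext => x; rewrite mulN1r.
- by move=> x Wx; rewrite W1// mul1r subrr.
Qed.

End Localization.

(** * Fourier coefficients of smooth functions on a period *)

Section PeriodIntegral.
Local Open Scope classical_set_scope.
Context {R : realType}.
Implicit Types f g F : R -> R.

Definition period_int f : R := \int[lebesgue_measure]_(x in `[(- pi : R), pi]) f x.

Let integ f : continuous f -> lebesgue_measure.-integrable `[(- pi : R), pi] (EFin \o f).
Proof.
move=> cf; apply: continuous_compact_integrable; first exact: segment_compact.
exact: continuous_subspaceT.
Qed.

Lemma period_intD f g : continuous f -> continuous g ->
  period_int (fun x => f x + g x) = period_int f + period_int g.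
Proof. by move=> cf cg; rewrite /period_int RintegralD//; exact: integ. Qed.

Lemma period_intZ (c : R) f : continuous f -> period_int (fun x => c * f x) = c * period_int f.
Proof. by move=> cf; rewrite /period_int RintegralZl//; exact: integ. Qed.

Lemma le_pint f g : continuous f -> continuous g ->
  (forall x, - pi <= x <= pi -> f x <= g x) -> period_int f <= period_int g.
Proof.
move=> cf cg fg; apply: le_Rintegral => //; exact: integ.
Qed.

Lemma period_int_derive F : smooth1 F -> period_int F^`() = F pi - F (- pi).
Proof.
move=> sF; have cF := smooth1_continuous sF.
have cF' := smooth1_continuous (smooth1_deriv sF).
rewrite /period_int /Rintegral (@continuous_FTC2 _ _ F)//.
- by rewrite (lt_trans (_ : _ < 0)) ?oppr_lt0 ?pi_gt0.
- exact: continuous_subspaceT.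
- split.
  + by move=> x _; exact: smooth1_derivable.
  + by apply: cvg_at_right_filter; exact: cF.
  + by apply: cvg_at_left_filter; exact: cF.
Qed.

Lemma period_int_cst (c : R) : period_int (fun=> c) = 2 * pi * c.
Proof.
have s : smooth1 (fun x : R => id (c * x + 0)).
  exact: smooth1_affine smooth1_id.
have := period_int_derive s.
rewrite (_ : _^`() = (fun=> c)); last first.
  by apply/funext => x; rewrite derive1E (@derive_val _ _ _ _ _ _ _ (is_derive_affine c 0 x)).
by move=> ->; rewrite /=; ring.
Qed.

Lemma period_int_sum (J : Type) (r : seq J) (F : J -> R -> R) :
  (forall j, continuous (F j)) ->
  period_int (fun x => \sum_(j <- r) F j x) = \sum_(j <- r) period_int (F j).
Proof.
move=> cF; elim: r => [|j r IH].
  under [in LHS]eq_fun do rewrite big_nil.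
  by rewrite big_nil period_int_cst mulr0.
under [in LHS]eq_fun do rewrite big_cons.
rewrite big_cons -IH period_intD//; apply: continuous_big => //; exact: add_continuous.
Qed.

Lemma period_int_norm f (M : R) : continuous f -> (forall x, `|f x| <= M) ->
  `|period_int f| <= 2 * pi * M.
Proof.
move=> cf fM; rewrite ler_norml -mulrN -!period_int_cst.
have cc (c : R) : continuous (fun _ : R => c) by move=> x; exact: cst_continuous.
by apply/andP; split; apply: le_pint => // x _; have := fM x; rewrite ler_norml => /andP[].
Qed.

End PeriodIntegral.

Section FourierCoefficients.
Local Open Scope classical_set_scope.
Context {R : realType}.
Implicit Types (f g : R -> R) (w x t : R) (m n p k : nat).

Definition fcos w g : R := period_int (fun s => g s * cos (w * s)).
Definition fsin w g : R := period_int (fun s => g s * sin (w * s)).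

Lemma smooth1_scale g w : smooth1 g -> smooth1 (fun x => g (w * x)).
Proof.
move=> sg; rewrite (_ : (fun x => g (w * x)) = fun x => g (w * x + 0)).
  exact: smooth1_affine.
by apply/funext => x; rewrite addr0.
Qed.

Lemma smooth1_coswx w : smooth1 (fun x => cos (w * x)).
Proof. by apply: smooth1_scale; exact: (@smooth1_trig R).1. Qed.
Lemma smooth1_sinwx w : smooth1 (fun x => sin (w * x)).
Proof. by apply: smooth1_scale; exact: (@smooth1_trig R).2. Qed.

Lemma derive1_coswx w : derive1 (fun x => cos (w * x)) = fun x => - w * sin (w * x).
Proof.
apply/funext => x; rewrite derive1E.
have H : is_derive x (1 : R) (fun t => w * t) w.
  by have := is_derive_affine w 0 x; under eq_fun do rewrite addr0.
by rewrite (@derive_val _ _ _ _ _ _ _ (is_derive1_comp (is_derive_cos (w * x)) H)); ring.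
Qed.

Lemma derive1_sinwx w : derive1 (fun x => sin (w * x)) = fun x => w * cos (w * x).
Proof.
apply/funext => x; rewrite derive1E.
have H : is_derive x (1 : R) (fun t => w * t) w.
  by have := is_derive_affine w 0 x; under eq_fun do rewrite addr0.
by rewrite (@derive_val _ _ _ _ _ _ _ (is_derive1_comp (is_derive_sin (w * x)) H)); ring.
Qed.

Lemma deriv1M_smooth f g : smooth1 f -> smooth1 g ->
  derive1 (fun x => f x * g x) = fun x => derive1 f x * g x + f x * derive1 g x.
Proof.
move=> sf sg; rewrite (deriv1M (fun x => smooth1_derivable sf) (fun x => smooth1_derivable sg)).
by apply/funext => x /=; rewrite addrC mulrC.
Qed.

Definition supp1 g := forall t, 1 < `|t| -> g t = 0.

Lemma supp1_derive g : supp1 g -> supp1 g^`().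
Proof.
move=> g0 t t1; rewrite derive1E (_ : 'D_1 g t = 'D_1 (cst (0 : R)) t); first by rewrite derive_cst.
apply: (@near_eq_derive R R^o R^o).
have : \forall s \near t, 1 < `|s|.
  have cn : `|s| @[s --> t] --> `|t| by exact: (@norm_continuous R R^o t).
  exact: (cvgr_gt _ cn _ t1).
by apply: filterS => s s1; rewrite g0.
Qed.

Lemma supp1_derivn n g : supp1 g -> supp1 g^`(n).
Proof.
by elim: n g => [//|n IH] g gs; rewrite derive1Sn; apply: IH; exact: supp1_derive.
Qed.

Lemma supp1_bounded g : continuous g -> supp1 g -> exists2 M : R, 0 <= M & forall x, `|g x| <= M.
Proof.
move=> cg g0; have /compact_bounded[M [_ hM]] : compact (g @` `[(-1 : R), 1]).
  by apply: continuous_compact; [exact: continuous_subspaceT|exact: segment_compact].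
exists (`|M| + 1); first by rewrite addr_ge0.
move=> x; have [x1|x1] := leP `|x| 1; last by rewrite g0// normr0 addr_ge0.
apply: hM; first by rewrite (le_lt_trans (ler_norm _))// ltrDl.
by exists x => //=; rewrite in_itv /= -ler_norml.
Qed.

Lemma supp1_pi g : supp1 g -> g pi = 0 /\ g (- pi) = 0.
Proof.
move=> g0; have p1 : 1 < (pi : R) by rewrite (lt_le_trans _ (pi_ge2 _))// ltr1n.
by split; apply: g0; rewrite ?normrN gtr0_norm ?pi_gt0.
Qed.

Lemma fcos_derive w g : smooth1 g -> supp1 g -> fcos w g^`() = w * fsin w g.
Proof.
move=> sg g0; have [gp gm] := supp1_pi g0.
have sc := smooth1_coswx w; have ss := smooth1_sinwx w.
have := period_int_derive (smooth1M sg sc).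
rewrite /= gp gm !mul0r subrr (deriv1M_smooth sg sc) derive1_coswx.
have -> : (fun x => derive1 g x * cos (w * x) + g x * (- w * sin (w * x))) =
  (fun x => derive1 g x * cos (w * x) + - w * (g x * sin (w * x))).
  by apply/funext => x; ring.
rewrite period_intD; last 2 first.
- exact: smooth1_continuous (smooth1M (smooth1_deriv sg) sc).
- exact: smooth1_continuous (smooth1M (smooth1_cst _) (smooth1M sg ss)).
rewrite period_intZ; last exact: smooth1_continuous (smooth1M sg ss).
by rewrite mulNr => /subr0_eq.
Qed.

Lemma fsin_derive w g : smooth1 g -> supp1 g -> fsin w g^`() = - w * fcos w g.
Proof.
move=> sg g0; have [gp gm] := supp1_pi g0.
have sc := smooth1_coswx w; have ss := smooth1_sinwx w.
have := period_int_derive (smooth1M sg ss).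
rewrite /= gp gm !mul0r subrr (deriv1M_smooth sg ss) derive1_sinwx.
have -> : (fun x => derive1 g x * sin (w * x) + g x * (w * cos (w * x))) =
  (fun x => derive1 g x * sin (w * x) + w * (g x * cos (w * x))).
  by apply/funext => x; ring.
rewrite period_intD; last 2 first.
- exact: smooth1_continuous (smooth1M (smooth1_deriv sg) ss).
- exact: smooth1_continuous (smooth1M (smooth1_cst _) (smooth1M sg sc)).
rewrite period_intZ; last exact: smooth1_continuous (smooth1M sg sc).
by rewrite mulNr => /eqP; rewrite addr_eq0 => /eqP.
Qed.

(** Integration by parts: each power of the frequency costs one derivative, and
there are no boundary terms since g vanishes near the endpoints. The frequencies
are arbitrary reals. *)
Lemma fourier_decay p g : smooth1 g -> supp1 g -> exists2 C : R, 0 <= C &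
  forall w, `|w| ^+ p * `|fcos w g| <= C /\ `|w| ^+ p * `|fsin w g| <= C.
Proof.
elim: p g => [|p IH] g sg g0.
  have [M M0 gM] := supp1_bounded (smooth1_continuous sg) g0.
  exists (2 * pi * M); first by rewrite !mulr_ge0 ?pi_ge0.
  move=> w; rewrite expr0 !mul1r; split; apply: period_int_norm.
  - exact: smooth1_continuous (smooth1M sg (smooth1_coswx w)).
  - by move=> x; rewrite normrM -[leRHS]mulr1 ler_pM// cos_max.
  - exact: smooth1_continuous (smooth1M sg (smooth1_sinwx w)).
  - by move=> x; rewrite normrM -[leRHS]mulr1 ler_pM// sin_max.
have [C C0 HC] := IH _ (smooth1_deriv sg) (supp1_derive g0).
exists C => // w; have [] := HC w.
rewrite fcos_derive// fsin_derive// !normrM normrN !mulrA -!exprSr => h1 h2.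
by split.
Qed.

Lemma fourier_decay1 p g : smooth1 g -> supp1 g -> exists2 C : R, 0 <= C &
  forall w, (1 + `|w|) ^+ p * (`|fcos w g| + `|fsin w g|) <= C.
Proof.
move=> sg g0; have [C C0 HC] := fourier_decay p sg g0.
have [D D0 HD] := fourier_decay 0 sg g0.
exists (2 ^+ p * (2 * C + 2 * D)); first by rewrite mulr_ge0 ?exprn_ge0 ?addr_ge0 ?mulr_ge0.
move=> w; have [c1 c2] := HC w; have [] := HD w; rewrite expr0 !mul1r => d1 d2.
have : (1 + `|w|) ^+ p <= 2 ^+ p * (1 + `|w| ^+ p).
  rewrite mulrDr mulr1 -exprMn; have [w1|w1] := leP `|w| 1.
    rewrite (le_trans (_ : _ <= 2 ^+ p)) ?lerDl ?exprn_ge0 ?mulr_ge0//.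
    by rewrite lerXn2r ?nnegrE ?addr_ge0// lerD2l.
  rewrite (le_trans (_ : _ <= (2 * `|w|) ^+ p)) ?lerDr ?exprn_ge0//.
  by rewrite lerXn2r ?nnegrE ?addr_ge0 ?mulr_ge0// mulr_natl mulr2n lerD2r ltW.
move=> h; apply: (le_trans (ler_wpM2r _ h)); first by rewrite addr_ge0.
rewrite -mulrA ler_wpM2l ?exprn_ge0// mulrDl mul1r mulrDr addrC.
by rewrite lerD// mulr_natl mulr2n lerD.
Qed.

End FourierCoefficients.

(** * Approximation by trigonometric sums with uniformly decaying coefficients *)

Section Fejer.
Context {R : realType}.
Implicit Types (f g : R -> R) (w x t : R) (m n p k : nat).

(** All the differences a - b, with multiplicity: the Fejer kernel is the squared
modulus of a sum of m exponentials, and leaving the double sum uncollected makes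
both its positivity and its mass immediate. *)
Definition freqs m : seq R := [seq a%:R - b%:R | a <- iota 0 m, b <- iota 0 m].

(** Here the kernel has mass 2 pi m; the normalization is in [fejer]. *)
Definition fejer_kernel m t : R := \sum_(w <- freqs m) cos (w * t).

Definition trig_sum (l : seq (R * R * R)) x : R :=
  \sum_(q <- l) (q.1.1 * cos (q.2 * x) + q.1.2 * sin (q.2 * x)).

(** The Fejer mean of g, as a list of pairs of coefficients with a frequency. *)
Definition fejer m g : seq (R * R * R) :=
  [seq ((2 * pi * m%:R)^-1 * fcos w g, (2 * pi * m%:R)^-1 * fsin w g, w) | w <- freqs m].

Lemma smooth1_trig_term (a b w : R) : smooth1 (fun x => a * cos (w * x) + b * sin (w * x)).
Proof.
apply: (@smooth1D _ (fun x => a * cos (w * x)) (fun x => b * sin (w * x))).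
  exact: (smooth1M (smooth1_cst a) (smooth1_coswx w)).
exact: (smooth1M (smooth1_cst b) (smooth1_sinwx w)).
Qed.

Lemma trig_sum_cons q l : trig_sum (q :: l) =
  (fun x => q.1.1 * cos (q.2 * x) + q.1.2 * sin (q.2 * x)) \+ trig_sum l.
Proof. by apply/funext => x; rewrite /trig_sum big_cons. Qed.

Lemma trig_sum_nil : trig_sum [::] = cst 0.
Proof. by apply/funext => x; rewrite /trig_sum big_nil. Qed.

Lemma smooth1_trig_sum l : smooth1 (trig_sum l).
Proof.
elim: l => [|q l IH]; first by rewrite trig_sum_nil; exact: smooth1_cst.
by rewrite trig_sum_cons; apply: (smooth1D _ IH); exact: smooth1_trig_term.
Qed.

Lemma derive1_trig_term (a b w : R) :
  derive1 (fun x => a * cos (w * x) + b * sin (w * x)) =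
  fun x => (w * b) * cos (w * x) + (- w * a) * sin (w * x).
Proof.
have sa := smooth1M (smooth1_cst a) (smooth1_coswx w).
have sb := smooth1M (smooth1_cst b) (smooth1_sinwx w).
rewrite (deriv1D (fun x => smooth1_derivable sa (x := x)) (fun x => smooth1_derivable sb (x := x))).
apply/funext => x /=; rewrite (deriv1M_smooth (smooth1_cst a) (smooth1_coswx w)).
rewrite (deriv1M_smooth (smooth1_cst b) (smooth1_sinwx w)).
by rewrite derive1_coswx derive1_sinwx !derive1_cst /=; ring.
Qed.

(** Fejer means commute with derivatives, so uniform convergence for every function
gives convergence of all derivatives. *)
Lemma derive1_fejer m g : smooth1 g -> supp1 g ->
  derive1 (trig_sum (fejer m g)) = trig_sum (fejer m (derive1 g)).
Proof.
move=> sg g0; rewrite /fejer; elim: (freqs m) => [|w l IH] /=.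
  by rewrite trig_sum_nil; apply/funext => x; rewrite derive1_cst.
rewrite !trig_sum_cons (deriv1D _ (fun x => smooth1_derivable (smooth1_trig_sum _) (x := x))).
  rewrite IH derive1_trig_term /= fcos_derive// fsin_derive//.
  by apply/funext => x /=; congr (_ + _); ring.
by move=> x; apply: smooth1_derivable; exact: smooth1_trig_term.
Qed.

Lemma derive1n_fejer j m g : smooth1 g -> supp1 g ->
  derive1n j (trig_sum (fejer m g)) = trig_sum (fejer m (derive1n j g)).
Proof.
elim: j g => [//|j IH] g sg g0; rewrite !derive1Sn derive1_fejer// IH//.
  exact: smooth1_deriv.
exact: supp1_derive.
Qed.

Let conv_term g w x : smooth1 g ->
  period_int (fun s => g s * cos (w * (x - s))) = fcos w g * cos (w * x) + fsin w g * sin (w * x).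
Proof.
move=> sg; have sc := smooth1M sg (smooth1_coswx w); have ss := smooth1M sg (smooth1_sinwx w).
rewrite (_ : (fun s => _) = fun s =>
  cos (w * x) * (g s * cos (w * s)) + sin (w * x) * (g s * sin (w * s))); last first.
  by apply/funext => s; rewrite mulrBr cosB; ring.
rewrite period_intD; last 2 first.
- exact: smooth1_continuous (smooth1M (smooth1_cst _) sc).
- exact: smooth1_continuous (smooth1M (smooth1_cst _) ss).
rewrite !period_intZ; [|exact: smooth1_continuous ss|exact: smooth1_continuous sc].
by rewrite mulrC [X in _ + X]mulrC.
Qed.

Lemma smooth1_cos_shift w x : smooth1 (fun s => cos (w * (x - s))).
Proof.
rewrite (_ : (fun s => _) = fun s => cos (- w * s + w * x)).
  by apply: smooth1_affine; exact: (@smooth1_trig R).1.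
by apply/funext => s; congr cos; ring.
Qed.

Lemma smooth1_fejer_shift m x : smooth1 (fun s => fejer_kernel m (x - s)).
Proof.
rewrite /fejer_kernel; elim: (freqs m) => [|w l IH].
  by under eq_fun do rewrite big_nil; exact: smooth1_cst.
under eq_fun do rewrite big_cons.
exact: (smooth1D (smooth1_cos_shift w x) IH).
Qed.

Lemma fejer_conv m g x : smooth1 g ->
  trig_sum (fejer m g) x =
  (2 * pi * m%:R)^-1 * period_int (fun s => g s * fejer_kernel m (x - s)).
Proof.
move=> sg.
rewrite (_ : (fun s => _) = fun s => \sum_(w <- freqs m) g s * cos (w * (x - s))); last first.
  by apply/funext => s; rewrite mulr_sumr.
rewrite (period_int_sum _ (F := fun w s => g s * cos (w * (x - s)))); last first.
  by move=> w; exact: smooth1_continuous (smooth1M sg (smooth1_cos_shift w x)).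
rewrite /trig_sum /fejer big_map mulr_sumr; apply: eq_bigr => w _ /=.
by rewrite conv_term//; ring.
Qed.

Lemma sin_natpi n : sin (n%:R * pi) = 0 :> R.
Proof.
elim: n => [|n IH]; first by rewrite mul0r sin0.
by rewrite -addn1 natrD mulrDl mul1r sinDpi IH oppr0.
Qed.

Lemma period_int_cos_shift (a b : nat) x :
  period_int (fun s => cos ((a%:R - b%:R) * (x - s))) = 2 * pi * (a == b)%:R.
Proof.
have [->|ab] := eqVneq a b.
  by rewrite subrr; under eq_fun do rewrite mul0r cos0; rewrite period_int_cst.
set w := a%:R - b%:R; have w0 : w != 0 by rewrite subr_eq0 eqr_nat.
have swpi : sin (w * pi) = 0 by rewrite mulrBl sinB !sin_natpi mul0r mulr0 subrr.
rewrite mulr0; have E : (fun s => cos (w * (x - s))) =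
   derive1 (fun s => - (w^-1 * sin (w * x)) * cos (w * s) + w^-1 * cos (w * x) * sin (w * s)).
  rewrite derive1_trig_term; apply/funext => s; rewrite mulrBr cosB.
  by field.
rewrite E period_int_derive; last exact: smooth1_trig_term.
by rewrite mulrN cosN sinN swpi; ring.
Qed.

Lemma period_int_fejer m x : period_int (fun s => fejer_kernel m (x - s)) = 2 * pi * m%:R.
Proof.
rewrite /fejer_kernel (period_int_sum _ (F := fun w s => cos (w * (x - s)))); last first.
  by move=> w; exact: smooth1_continuous (smooth1_cos_shift w x).
rewrite /freqs big_allpairs_dep -[in RHS](size_iota 0 m) -sum1_size natr_sum mulr_sumr.
rewrite big_seq [RHS]big_seq; apply: eq_bigr => a am.
rewrite (bigD1_seq a) ?iota_uniq//= period_int_cos_shift eqxx big1 ?addr0// => b ba.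
by rewrite period_int_cos_shift eq_sym (negbTE ba) mulr0.
Qed.

(** Real and imaginary parts of the sum of the exponentials exp(i a t). *)
Lemma fejer_kernelE m t : fejer_kernel m t =
  (\sum_(a <- iota 0 m) cos (a%:R * t)) ^+ 2 + (\sum_(a <- iota 0 m) sin (a%:R * t)) ^+ 2.
Proof.
rewrite /fejer_kernel /freqs big_allpairs_dep !expr2 !mulr_suml -big_split.
apply: eq_bigr => a _; rewrite !mulr_sumr -big_split; apply: eq_bigr => b _.
by rewrite mulrBl cosB.
Qed.

Lemma fejer_kernel_ge0 m t : 0 <= fejer_kernel m t.
Proof. by rewrite fejer_kernelE addr_ge0 ?sqr_ge0. Qed.

(** The geometric sum (e^(it) - 1) sum_a e^(iat) = e^(imt) - 1, squared. Its bound by 2,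
uniform in m, expresses that the mass concentrates at t = 0. *)
Lemma fejer_kernel_closed m t :
  (1 - cos t) * fejer_kernel m t = 1 - cos (m%:R * t).
Proof.
rewrite fejer_kernelE.
set C := \sum_(_ <- _) cos _; set S := \sum_(_ <- _) sin _.
(* The real and imaginary parts of the geometric sum. *)
have [EC ES] : C * (cos t - 1) - S * sin t = cos (m%:R * t) - 1 /\
    C * sin t + S * (cos t - 1) = sin (m%:R * t).
  rewrite /C /S; elim: m {C S} => [|m [IH1 IH2]].
    by rewrite !big_nil mulr0n !mul0r cos0 sin0; split; ring.
  have -> : m.+1%:R * t = m%:R * t + t by rewrite -addn1 natrD mulrDl mul1r.
  rewrite -addn1 iotaD !big_cat !big_seq1 add0n cosD sinD /=.
  move: IH1 IH2; set c := \sum_(_ <- _) cos _; set s := \sum_(_ <- _) sin _ => IH1 IH2.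
  split.
    transitivity (c * (cos t - 1) - s * sin t +
      (cos (m%:R * t) * (cos t - 1) - sin (m%:R * t) * sin t)); first by ring.
    by rewrite IH1; ring.
  transitivity (c * sin t + s * (cos t - 1) +
    (cos (m%:R * t) * sin t + sin (m%:R * t) * (cos t - 1))); first by ring.
  by rewrite IH2; ring.
have c2 := cos2Dsin2 t; have cm := cos2Dsin2 (m%:R * t).
have H : (C ^+ 2 + S ^+ 2) * ((cos t - 1) ^+ 2 + sin t ^+ 2) =
    (cos (m%:R * t) - 1) ^+ 2 + sin (m%:R * t) ^+ 2 by rewrite -EC -ES; ring.
have Et : (cos t - 1) ^+ 2 + sin t ^+ 2 = 2 * (1 - cos t) by rewrite sin2cos2; ring.
have Em : (cos (m%:R * t) - 1) ^+ 2 + sin (m%:R * t) ^+ 2 = 2 * (1 - cos (m%:R * t)).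
  by rewrite sin2cos2; ring.
move: H; rewrite Et Em => H; apply: (@mulfI _ 2); first by rewrite pnatr_eq0.
by rewrite -H; ring.
Qed.

(** For x in [-1, 1] and s in the period, x - s stays in [-pi - 1, pi + 1], hence away
from the zeros of 1 - cos other than 0. *)
Lemma cos_away (delta t : R) : 0 < delta <= 1 -> delta <= `|t| -> `|t| <= pi + 1 ->
  cos t <= cos delta.
Proof.
move=> /andP[d0 d1] dt tp; rewrite -(cos_norm t); set a := `|t| in dt tp *.
have p2 := pi_ge2 R; have pge1 : 1 <= pi :> R by rewrite (le_trans _ p2)// ler1n.
have [ap|pa] := leP a pi.
  have [->//|da] := eqVneq a delta; apply/ltW.
  have aI : a \in `[0, pi] by rewrite in_itv /= ap (le_trans (ltW d0)).
  have dI : delta \in `[0, pi] by rewrite in_itv /= (ltW d0) (le_trans d1).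
  by rewrite (ltr_cos dI aI) lt_neqAle eq_sym da.
have pos x : 0 <= x <= 1 -> 0 < cos x.
  move=> /andP[x0 x1]; apply: cos_gt0_pihalf; apply/andP; split.
    by rewrite (lt_le_trans _ x0)// oppr_lt0 divr_gt0 ?pi_gt0.
  have [->|xn1] := eqVneq x 1; last first.
    by rewrite (@lt_le_trans _ _ 1)// ?pihalf_ge1// lt_neqAle xn1.
  rewrite lt_neqAle pihalf_ge1 andbT; apply/eqP => E.
  by have := cos1_gt0 R; rewrite [X in cos X]E cos_pihalf ltxx.
rewrite -[a](subrK pi) cosDpi (@le_trans _ _ 0)//; last first.
  by apply/ltW/pos; rewrite (ltW d0).
by rewrite oppr_le0 ltW// pos// subr_ge0 (ltW pa) lerBlDl.
Qed.

Lemma lipschitz_of_supp1 g : smooth1 g -> supp1 g -> exists2 L : R, 0 <= L &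
  forall x y, `|g x - g y| <= L * `|x - y|.
Proof.
move=> sg g0; have [L L0 HL] :=
  supp1_bounded (smooth1_continuous (smooth1_deriv sg)) (supp1_derive g0).
exists L => // x y; wlog xy : x y / x < y => [H|].
  have [xy|xy|->] := ltgtP x y; first exact: H.
    by rewrite distrC (distrC x); exact: H.
  by rewrite !subrr normr0 mulr0.
have [||c _ E] := @MVT R g (derive1 g) x y xy.
- by move=> z _; split; [exact: smooth1_derivable|rewrite derive1E].
- exact/continuous_subspaceT/smooth1_continuous.
- by rewrite distrC E normrM (distrC x) ler_wpM2r.
Qed.

(** Near the diagonal |g(s) - g(x)| is small by the Lipschitz bound and the kernel has
mass 2 pi m; away from it the kernel is bounded by a constant independent of m.
Division by m concludes. *)
Lemma fejer_approx g (e : R) : smooth1 g -> supp1 g -> 0 < e ->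
  exists m0, (0 < m0)%N /\ forall m, (m0 <= m)%N -> forall x, `|x| <= 1 ->
    `|trig_sum (fejer m g) x - g x| <= e.
Proof.
move=> sg g0 e0.
have [L L0 HL] := lipschitz_of_supp1 sg g0.
have [M M0 HM] := supp1_bounded (smooth1_continuous sg) g0.
pose delta : R := Num.min 1 (e / (2 * (L + 1))).
have L1 : 0 < L + 1 by rewrite ltr_wpDl.
have d0 : 0 < delta by rewrite lt_min ltr01 divr_gt0 ?mulr_gt0.
have d1 : delta <= 1 by rewrite ge_min lexx.
have Ld : L * delta <= e / 2.
  apply: (@le_trans _ _ ((L + 1) * (e / (2 * (L + 1))))).
    by rewrite ler_pM ?(ltW d0) ?lerDl// ge_min lexx orbT.
  by rewrite le_eqVlt; apply/orP; left; apply/eqP; field; rewrite gt_eqF.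
have cd : 0 < 1 - cos delta.
  have zI : (0 : R) \in `[0, pi] by rewrite in_itv /= lexx pi_ge0.
  have dI : delta \in `[0, pi].
    by rewrite in_itv /= (ltW d0) (le_trans d1)// (le_trans _ (pi_ge2 _))// ler1n.
  by rewrite subr_gt0 -(cos0 R) (ltr_cos zI dI).
(* Bounds (g s - g x) times the kernel where |x - s| > delta. *)
pose c := 2 * M / (1 - cos delta) * 2.
have c0 : 0 <= c by rewrite mulr_ge0// divr_ge0 ?(ltW cd)// mulr_ge0.
pose m0 := (Num.truncn (2 * c / e)).+1.
exists m0; split => // m mm0 x x1.
have m_gt0 : 0 < m%:R :> R by rewrite ltr0n (leq_trans _ mm0).
have cm : c / m%:R <= e / 2.
  have h : 2 * c / e <= m%:R.
    by rewrite (le_trans (ltW (truncnS_gt _)))// ler_nat.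
  move: h; rewrite ler_pdivrMr// => h; rewrite ler_pdivrMr//.
  by move: h; rewrite mulrC [X in _ -> _ <= X]mulrAC ler_pdivlMr// [m%:R * e]mulrC.
have scv := smooth1_fejer_shift m x.
have Eg : g x = (2 * pi * m%:R)^-1 * period_int (fun s => g x * fejer_kernel m (x - s)).
  rewrite period_intZ; last exact: smooth1_continuous scv.
  by rewrite period_int_fejer mulrCA mulVf ?mulr1// gt_eqF// !mulr_gt0 ?pi_gt0.
have sgx := smooth1M (smooth1_cst (g x)) scv.
have sgs := smooth1M sg scv.
have sD := smooth1D sgs (smooth1M (smooth1_cst (-1)) sgx).
rewrite fejer_conv// [X in _ - X]Eg -mulrBr.
have -> : period_int (fun s => g s * fejer_kernel m (x - s)) -
    period_int (fun s => g x * fejer_kernel m (x - s)) =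
    period_int (fun s => (g s - g x) * fejer_kernel m (x - s)).
  rewrite -[X in _ + X = _]mulN1r -period_intZ; last exact: smooth1_continuous sgx.
  rewrite -period_intD.
  - by congr period_int; apply/funext => s; ring.
  - exact: smooth1_continuous sgs.
  - exact: smooth1_continuous (smooth1M (smooth1_cst (-1)) sgx).
have sE : smooth1 (fun s => (g s - g x) * fejer_kernel m (x - s)).
  have -> // : (fun s => (g s - g x) * fejer_kernel m (x - s)) =
    (fun s => g s * fejer_kernel m (x - s)) \+
       (cst (-1) \* (fun s => g x * fejer_kernel m (x - s))).
  by apply/funext => s /=; ring.
pose B s := L * delta * fejer_kernel m (x - s) + c.
have sB : smooth1 B.
  exact: (smooth1D (smooth1M (smooth1_cst (L * delta)) scv) (smooth1_cst c)).
have EB : period_int B = 2 * pi * m%:R * (L * delta) + 2 * pi * c.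
  rewrite /B period_intD; last 2 first.
  - exact: smooth1_continuous (smooth1M (smooth1_cst (L * delta)) scv).
  - exact: smooth1_continuous (smooth1_cst c).
  rewrite period_intZ; last exact: smooth1_continuous scv.
  by rewrite period_int_fejer period_int_cst; ring.
have key s : - pi <= s <= pi -> `|(g s - g x) * fejer_kernel m (x - s)| <= B s.
  move=> sp; rewrite normrM (ger0_norm (fejer_kernel_ge0 _ _)) /B.
  have [sx|sx] := leP `|x - s| delta.
    apply: ler_wpDr => //; rewrite ler_wpM2r ?fejer_kernel_ge0//.
    by rewrite (le_trans (HL _ _))// ler_wpM2l// distrC.
  apply: ler_wpDl; first by rewrite !mulr_ge0 ?(ltW d0) ?fejer_kernel_ge0.
  apply: (@le_trans _ _ (2 * M * fejer_kernel m (x - s))).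
    rewrite ler_wpM2r ?fejer_kernel_ge0// (le_trans (ler_normB _ _))//.
    by rewrite mulr_natl mulr2n lerD.
  have a1 : 1 - cos delta <= 1 - cos (x - s).
    rewrite lerD2l lerN2; apply: cos_away; [by rewrite d0|exact: ltW|].
    rewrite (le_trans (ler_normB _ _))// addrC lerD//.
    by rewrite ler_norml.
  have h : (1 - cos delta) * fejer_kernel m (x - s) <= 2.
    apply: (le_trans (ler_wpM2r (fejer_kernel_ge0 _ _) a1)).
    by rewrite fejer_kernel_closed; have := cos_geN1 (m%:R * (x - s)); lra.
  rewrite /c -[leRHS]mulrA ler_wpM2l ?mulr_ge0//.
  by rewrite [leRHS]mulrC ler_pdivlMr// mulrC.
have pB : `|period_int (fun s => (g s - g x) * fejer_kernel m (x - s))| <= period_int B.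
  rewrite ler_norml; apply/andP; split.
    rewrite -mulN1r -period_intZ; last exact: smooth1_continuous sB.
    apply: le_pint.
    - exact: smooth1_continuous (smooth1M (smooth1_cst (-1)) sB).
    - exact: smooth1_continuous sE.
    - by move=> s /key; rewrite ler_norml mulN1r => /andP[].
  apply: le_pint; [exact: smooth1_continuous sE|exact: smooth1_continuous sB|].
  by move=> s /key; rewrite ler_norml => /andP[].
have q0 : 0 < 2 * pi * m%:R :> R by rewrite !mulr_gt0 ?pi_gt0.
rewrite normrM gtr0_norm ?invr_gt0// ler_pdivrMl//.
apply: (le_trans pB); rewrite EB.
have -> : 2 * pi * m%:R * (L * delta) + 2 * pi * c =
    2 * pi * m%:R * (L * delta + c / m%:R).
  rewrite [RHS]mulrDr; congr (_ + _); rewrite -[RHS]mulrA; congr (_ * _).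
  by rewrite mulrCA divff ?mulr1// gt_eqF.
rewrite ler_wpM2l ?(ltW q0)//.
have -> : e = e / 2 + e / 2 by field.
exact: lerD.
Qed.

(** Telescoping along the bounded increasing function t / (1 + |t|), whose increment
between consecutive integers dominates the summand up to a factor 2. *)
Lemma sum_inv_sqr_le (a m : nat) :
  \sum_(b <- iota 0 m) ((1 + `|a%:R - b%:R|) ^+ 2)^-1 <= 4 :> R.
Proof.
pose h (t : R) := t / (1 + `|t|).
have h1 t : `|h t| <= 1.
  rewrite /h normrM normfV [`|1 + _|]ger0_norm ?addr_ge0// ler_pdivrMr ?ltr_pwDl//.
  by rewrite mul1r lerDr.
have tele (t : R) : 0 <= t \/ t <= -1 ->
    ((1 + `|t|) ^+ 2)^-1 <= 2 * (h (t + 1) - h t).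
  rewrite /h => -[t0|t1].
    have -> : `|t| = t by exact: ger0_norm.
    have -> : `|t + 1| = t + 1 by apply: ger0_norm; lra.
    rewrite -subr_ge0 (_ : _ - _ = t / ((1 + t) ^+ 2 * (2 + t))).
      by rewrite divr_ge0 ?mulr_ge0 ?exprn_ge0//; lra.
    by field; apply/andP; split; rewrite gt_eqF//; lra.
  have -> : `|t| = - t by apply: ler0_norm; lra.
  have -> : `|t + 1| = - (t + 1) by apply: ler0_norm; lra.
  rewrite -subr_ge0 (_ : _ - _ = (2 - t) / (- t * (1 - t) ^+ 2)).
    by rewrite divr_ge0 ?mulr_ge0 ?exprn_ge0//; lra.
  by field; apply/and3P; split; apply/eqP => E; lra.
have step (b : nat) : ((1 + `|a%:R - b%:R|) ^+ 2)^-1 <=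
    2 * (h (b.+1%:R - a%:R) - h (b%:R - a%:R)).
  have -> : b.+1%:R - a%:R = (b%:R - a%:R) + 1 :> R by rewrite -addn1 natrD addrAC.
  rewrite distrC; apply: tele; have [ab|ba] := leqP a b.
    by left; rewrite subr_ge0 ler_nat.
  have ba' : b%:R + 1 <= a%:R :> R by rewrite natr1 ler_nat.
  by right; lra.
apply: (@le_trans _ _ (2 * (h (m%:R - a%:R) - h (0 - a%:R)))).
  elim: m => [|m IH]; first by rewrite big_nil subrr mulr0.
  rewrite -addn1 iotaD big_cat big_seq1 add0n addn1 /=.
  rewrite (le_trans (lerD IH (step m)))// -mulrDr ler_wpM2l//.
  by rewrite addrC addrA subrK.
have := h1 (m%:R - a%:R); have := h1 (0 - a%:R).
by rewrite !ler_norml => /andP[u1 u2] /andP[v1 v2]; lra.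
Qed.

Lemma fejer_weight g p : smooth1 g -> supp1 g -> exists2 C : R, 0 <= C &
  forall m, (0 < m)%N ->
    \sum_(q <- fejer m g) (`|q.1.1| + `|q.1.2|) * (1 + `|q.2|) ^+ p <= C.
Proof.
move=> sg g0; have [D D0 HD] := fourier_decay1 p.+2 sg g0.
exists (4 * D) => [|m m0]; first by rewrite mulr_ge0.
have m0' : 0 < m%:R :> R by rewrite ltr0n.
have q0 : 0 < 2 * pi * m%:R :> R by rewrite !mulr_gt0 ?pi_gt0.
rewrite /fejer big_map /= /freqs big_allpairs_dep.
apply: (@le_trans _ _ (\sum_(a <- iota 0 m) (2 * pi * m%:R)^-1 * (D * 4))).
  apply: ler_sum => a _.
  apply: (@le_trans _ _ (\sum_(b <- iota 0 m) (2 * pi * m%:R)^-1 *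
     (D * ((1 + `|a%:R - b%:R|) ^+ 2)^-1))).
    apply: ler_sum => b _; set w := a%:R - b%:R.
    rewrite !normrM gtr0_norm ?invr_gt0// -mulrDr -mulrA ler_wpM2l ?invr_ge0 ?(ltW q0)//.
    have w0 : 0 < 1 + `|w| by rewrite ltr_pwDl.
    by rewrite ler_pdivlMr ?exprn_gt0// -mulrA -exprD addn2 mulrC.
  rewrite -!mulr_sumr ler_wpM2l ?invr_ge0 ?(ltW q0)// ler_wpM2l//.
  exact: sum_inv_sqr_le.
rewrite big_const_seq count_predT size_iota iter_addr_0 -mulr_natr.
rewrite [leLHS](_ : _ = (4 * D) / (2 * pi)); last first.
  have pn0 : pi != 0 :> R by rewrite gt_eqF ?pi_gt0.
  have mn0 : m%:R != 0 :> R by rewrite gt_eqF.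
  by move: (pi : R) pn0 => P Pn0; field; rewrite ?Pn0 ?mn0.
have p2 := pi_ge2 R.
rewrite ler_pdivrMr ?mulr_gt0 ?pi_gt0// ler_peMr ?mulr_ge0//.
by rewrite (le_trans _ (_ : 2 * 2 <= _)) ?ler_wpM2l//; lra.
Qed.

Lemma derive1n_scale j f (a : R) : smooth1 f ->
  derive1n j (fun s => f (a * s)) = fun s => a ^+ j * derive1n j f (a * s).
Proof.
move=> sf; elim: j => [|j IH]; first by apply/funext => s; rewrite expr0 mul1r.
have sj := smooth1_derivn j sf.
rewrite !derive1nS IH (deriv1M_smooth (smooth1_cst (a ^+ j)) (smooth1_scale a sj)).
apply/funext => s; rewrite derive1_cst mul0r add0r /= exprSr -mulrA; congr (_ * _).
have H : is_derive s (1 : R) (fun t => a * t) a.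
  by have := is_derive_affine a 0 s; under eq_fun do rewrite addr0.
have da : derivable (fun t => a * t) s 1 by case: H.
have df : derivable (derive1n j f) (a * s) 1 by exact: smooth1_derivable.
rewrite [LHS](derive1_comp da df) mulrC; congr (_ * _).
by rewrite derive1E; apply: derive_val.
Qed.

Lemma derive1nB j f g : smooth1 f -> smooth1 g ->
  derive1n j (fun s => f s - g s) = fun s => derive1n j f s - derive1n j g s.
Proof.
move=> sf sg; elim: j => [//|j IH]; rewrite !derive1nS IH; apply/funext => s.
have df := smooth1_derivable (smooth1_derivn j sf) (x := s).
have dg := smooth1_derivable (smooth1_derivn j sg) (x := s).
by rewrite !derive1E (deriveB df dg).
Qed.

(** The point is the order of the quantifiers: the weighted sum of the coefficients
is bounded before the accuracy e is chosen. The period is rescaled to make room for the interval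
[-B, B]. *)
Lemma trig_approx g p k (B : R) : smooth1 g -> (forall t, B < `|t| -> g t = 0) -> 1 <= B ->
  exists2 C : R, 0 <= C & forall e : R, 0 < e -> exists l : seq (R * R * R),
    \sum_(q <- l) (`|q.1.1| + `|q.1.2|) * (1 + `|q.2|) ^+ p <= C /\
    forall j, (j <= k)%N -> forall t, `|t| <= B ->
      `|derive1n j (fun s => trig_sum l s - g s) t| <= e.
Proof.
move=> sg gB B1; have B0 : 0 < B := lt_le_trans ltr01 B1.
pose h t := g (B * t).
have sh : smooth1 h by exact: smooth1_scale.
have h0 : supp1 h.
  by move=> t t1; apply: gB; rewrite normrM (gtr0_norm B0) ltr_pMr.
have [C C0 HC] := fejer_weight p sh h0; exists C => // e e0.
have /choice[m0 Hm0] j := fejer_approx (smooth1_derivn j sh) (supp1_derivn j h0) e0.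
pose m := \max_(j < k.+1) m0 j.
have mm0 j : (j <= k)%N -> (m0 j <= m)%N.
  move=> jk; pose j' := Ordinal (n := k.+1) (m := j) jk.
  exact: (leq_bigmax (F := fun j : 'I_k.+1 => m0 j) j').
have m_gt0 : (0 < m)%N by exact: leq_trans (Hm0 0%N).1 (mm0 _ _).
exists [seq (q.1, B^-1 * q.2) | q <- fejer m h]; split.
  apply: le_trans (HC m m_gt0); rewrite big_map; apply: ler_sum => q _ /=.
  rewrite ler_wpM2l ?addr_ge0// lerXn2r ?nnegrE ?addr_ge0// lerD2l normrM.
  by rewrite ler_piMl// gtr0_norm ?invr_gt0// invf_le1.
move=> j jk t tB.
pose E r := trig_sum (fejer m h) r - h r.
have -> : (fun s => trig_sum [seq (q.1, B^-1 * q.2) | q <- fejer m h] s - g s) =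
    (fun s => E (B^-1 * s)).
  apply/funext => s; rewrite /E; congr (_ - _); last by rewrite /h mulrA divff ?mul1r// gt_eqF.
  by rewrite /trig_sum big_map; apply: eq_bigr => q _ /=; rewrite !mulrA ![_ * B^-1]mulrC.
rewrite (@derive1n_scale j E); last first.
  have -> : E = trig_sum (fejer m h) \+ (cst (-1) \* h).
    by apply/funext => r /=; rewrite mulN1r.
  exact: (smooth1D (smooth1_trig_sum _) (smooth1M (smooth1_cst _) sh)).
rewrite /E derive1nB//; last exact: smooth1_trig_sum.
rewrite derive1n_fejer// normrM.
have Bi : `|B^-1| <= 1 by rewrite gtr0_norm ?invr_gt0// invf_le1.
apply: (@le_trans _ _ (1 * e)); last by rewrite mul1r.
apply: ler_pM => //; first by rewrite normrX exprn_ile1.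
apply: (Hm0 j).2; first exact: mm0.
by rewrite normrM gtr0_norm ?invr_gt0// ler_pdivrMl// mulr1.
Qed.

End Fejer.

(** * Factorial estimates and reindexing of sequences *)

Section Factorials.
Context {R : realType}.
Implicit Types (a s h q tau : R) (M N : nat).

Lemma expn_le_expR_fact q N : 0 <= q -> q ^+ N <= expR q * N`!%:R.
Proof.
move=> q0; rewrite -ler_pdivrMr ?ltr0n ?fact_gt0//.
case: N => [|N]; first by rewrite expr0 fact0 divr1 -expR0 ler_expR.
by apply: (le_trans _ (expR_ge1Dxn N q0)); rewrite lerDr.
Qed.

Lemma fact_beats_exp q tau : 0 < q -> 0 < tau ->
  exists2 A : R, 0 < A & forall N, q ^+ N <= A * N`!%:R `^ tau.
Proof.
move=> q0 t0; pose r := q `^ tau^-1.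
exists (expR r `^ tau); first by rewrite powR_gt0 ?expR_gt0.
move=> N; rewrite -powRM ?expR_ge0//.
have -> : q ^+ N = (r ^+ N) `^ tau.
  rewrite -[r ^+ N]powR_mulrn ?powR_ge0// powRAC powR_mulrn ?powR_ge0// /r.
  by rewrite -powRrM mulVf ?gt_eqF// powRr1// ltW.
apply: ge0_ler_powR; rewrite ?nnegrE ?exprn_ge0 ?powR_ge0 ?mulr_ge0 ?expR_ge0//.
  exact: ltW.
by apply: expn_le_expR_fact; exact: powR_ge0.
Qed.

Lemma fact_le_expn M : (M`! <= M ^ M)%N.
Proof.
elim: M => [//|M IH]; rewrite factS expnS leq_mul2l (leq_trans IH)//=.
by case: M {IH} => [//|M]; rewrite leq_exp2r.
Qed.

(** With 1 + del = 1/a one has ln M <= M^del / del, so the logarithm of the left-hand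
side is at most of order M^(1/a), that is of order N. *)
Lemma fact_subexp a s h : 0 < a < 1 -> 0 <= s -> 1 <= h ->
  exists E D : R, [/\ 0 < E, 0 < D & forall N M, M%:R <= N%:R `^ a + 1 ->
    h ^+ M * M`!%:R `^ s <= D * E ^+ N].
Proof.
move=> /andP[a0 a1] s0 h1; have h0 : 0 < h := lt_le_trans ltr01 h1.
(* The exponent 1/a > 1 leaves room for the logarithm in M ln M. *)
pose del := a^-1 - 1.
have del0 : 0 < del by rewrite subr_gt0 invf_gt1.
pose K := ln h + s / del.
have K0 : 0 <= K by rewrite addr_ge0 ?ln_ge0// divr_ge0// ltW.
exists (expR (K * 2 `^ a^-1)), h; split => //; first exact: expR_gt0.
move=> N M MN.
have E1 : 1 <= expR (K * 2 `^ a^-1) by rewrite -expR0 ler_expR mulr_ge0 ?powR_ge0.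
have [M1|M1] := leqP M 1.
  rewrite (_ : M`! = 1%N) ?powR1 ?mulr1; last by case: (M) M1 => [|[]].
  apply: (@le_trans _ _ (h * 1)); last by rewrite ler_wpM2l ?(ltW h0)// exprn_ege1.
  by rewrite mulr1; case: (M) M1 => [|[]]//.
have M0 : 1 <= M%:R :> R by rewrite ler1n ltnW.
have N1 : 1 <= N%:R `^ a.
  have : 2 <= N%:R `^ a + 1 :> R by rewrite (le_trans _ MN)// ler_nat.
  by rewrite -[2]/(1 + 1) lerD2r.
have M2 : M%:R <= 2 * N%:R `^ a by rewrite (le_trans MN)// mulr_natl mulr2n lerD2l.
have MX : M%:R `^ a^-1 <= 2 `^ a^-1 * N%:R.
  apply: (@le_trans _ _ ((2 * N%:R `^ a) `^ a^-1)).
    apply: ge0_ler_powR; rewrite ?nnegrE ?mulr_ge0 ?powR_ge0// ?invr_ge0; exact: ltW.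
  by rewrite powRM ?powR_ge0// -powRrM divff ?gt_eqF// powRr1.
have lnM : ln M%:R <= M%:R `^ del / del.
  rewrite ler_pdivlMr// mulrC -ln_powR; apply: ltW; apply: ln_sublinear.
  by rewrite powR_gt0// (lt_le_trans ltr01).
have Md1 : 1 <= M%:R `^ del.
  apply: (@le_trans _ _ (M%:R `^ 0)); first by rewrite powRr0.
  by apply: ler_powR => //; exact: ltW.
have key : ln h + s * ln M%:R <= K * M%:R `^ del.
  rewrite /K mulrDl lerD//; first by rewrite ler_peMr// ln_ge0.
  by rewrite -mulrA ler_wpM2l// [leRHS]mulrC.
have M0' : 0 < M%:R :> R by rewrite (lt_le_trans ltr01).
apply: (@le_trans _ _ (expR (M%:R * (ln h + s * ln M%:R)))).
  rewrite mulrDr expRD ler_pM ?exprn_ge0 ?powR_ge0 ?(ltW h0)//.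
    by rewrite expRM_natl lnK.
  have -> : expR (M%:R * (s * ln M%:R)) = (M%:R ^+ M) `^ s.
    rewrite mulrCA mulrC expRM expRM_natl lnK//.
  apply: ge0_ler_powR => //; rewrite ?nnegrE ?exprn_ge0//.
  by rewrite -natrX ler_nat fact_le_expn.
apply: (@le_trans _ _ (expR (K * (2 `^ a^-1 * N%:R)))).
  rewrite ler_expR (le_trans (ler_wpM2l _ key))// mulrCA ler_wpM2l//.
  by rewrite mulr_powRB1// ?invr_gt0.
by rewrite mulrA expRM_natr ler_peMl// exprn_ge0// expR_ge0.
Qed.

Lemma gevrey_absorb a s h h' tau : 0 < a < 1 -> 0 <= s -> 0 < h -> 0 < h' -> 0 < tau ->
  exists2 A : R, 0 < A & forall N M, M%:R <= N%:R `^ a + 1 ->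
    h ^+ M * M`!%:R `^ s <= A * (h' ^+ N * N`!%:R `^ tau).
Proof.
move=> a01 s0 h0 h'0 t0.
have [|E [D [E0 D0 HED]]] := @fact_subexp a s (Num.max 1 h) a01 s0.
  by rewrite le_max lexx.
have [A A0 HA] := @fact_beats_exp (E / h') tau (divr_gt0 E0 h'0) t0.
exists (D * A); first exact: mulr_gt0.
move=> N M /HED H; apply: (@le_trans _ _ (D * E ^+ N)).
  apply: le_trans H; rewrite ler_wpM2r ?powR_ge0// lerXn2r ?nnegrE ?(ltW h0)//.
    by rewrite le_max ler01.
  by rewrite le_max lexx orbT.
rewrite -mulrA ler_wpM2l ?(ltW D0)//.
have -> : E ^+ N = (E / h') ^+ N * h' ^+ N by rewrite -exprMn divfK// gt_eqF.
by rewrite mulrCA mulrC ler_wpM2l ?exprn_ge0 ?(ltW h'0).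
Qed.

End Factorials.

Section Reindexing.
Context {R : realType} {d : nat}.
Local Notation V := 'rV[R]_d.
Local Notation fct := (V -> R[i]).
Implicit Types (x xi : V) (U G W : set V) (uN : nat -> fct -> R[i]).

Lemma norm_le_enorm x : `|x| <= enorm x.
Proof.
apply: norm_le_coord => [|i]; first exact: sqrtr_ge0.
rewrite -sqrtr_sqr ler_wsqrtr// /dotv (bigD1 i)//= -expr2 lerDl.
by apply: sumr_ge0 => j _; rewrite -expr2 sqr_ge0.
Qed.

Lemma enorm_le_norm x : enorm x <= d%:R * `|x|.
Proof.
have h : 0 <= d%:R * `|x| by rewrite mulr_ge0.
rewrite -(ger0_norm h) -sqrtr_sqr ler_wsqrtr//.
have -> : (d%:R * `|x|) ^+ 2 = \sum_(i < d) d%:R * `|x| ^+ 2.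
  by rewrite sumr_const card_ord -[RHS]mulr_natl; ring.
apply: ler_sum => i _; rewrite -expr2 -(real_normK (num_real _)).
rewrite (@le_trans _ _ (`|x| ^+ 2))//; first by rewrite lerXn2r ?nnegrE// le_coord_norm.
rewrite ler_peMl ?exprn_ge0// ler1n.
by case: (d) i => // -[].
Qed.

Lemma enorm_gt0 xi : xi != 0 -> 0 < enorm xi.
Proof. by move=> xi0; rewrite (lt_le_trans _ (norm_le_enorm xi))// normr_gt0. Qed.

(** Tested against a bounded sequence of E'(U), this set gives a bound of the Fourier
transforms near the origin, uniform in N. *)
Lemma bounded_low_frequencies U : bounded_smooth U
  [set psi : fct | exists2 xi, enorm xi <= 1 & psi = fourier_exp xi].
Proof.
split=> [_ [xi _ ->] s x _|K k cK KU]; first exact: smooth_fourier_exp.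
exists ((1 + 2 * pi) ^+ k) => _ [xi xi1 ->].
have p0 : 0 <= 2 * pi :> R by rewrite mulr_ge0 ?pi_ge0.
have /andP[_] : 0 <= Cnorm K k (fourier_exp xi) <= (1 + 2 * pi) ^+ k; last by [].
apply: Cnorm_le; first by rewrite exprn_ge0// addr_ge0.
move=> x _ s sk; apply: (@le_trans _ _ ((1 + 2 * pi * `|xi|) ^+ k)); first exact: jet_le_fourier_exp.
have h : 0 <= 2 * pi * `|xi| by rewrite mulr_ge0.
apply: lerXn2r; rewrite ?nnegrE ?addr_ge0//.
rewrite lerD2l ler_piMr//; exact: le_trans (norm_le_enorm xi) xi1.
Qed.

(** For |xi| >= 1 the exponent e (M N) may be lowered to the required floor, and the
growth of the constants is absorbed by [gevrey_absorb]. For |xi| < 1 the required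
bound stays away from 0, so the boundedness of the sequence suffices. *)
Lemma reindex_decay kind U uN G (s A h a sigma tau : R) (e : nat -> int) (M : nat -> nat) :
  bounded_cdist_seq U uN -> 0 < a < 1 -> 0 <= s -> 0 < A -> 0 < h -> 0 < tau -> 0 < sigma ->
  (forall N xi, (0 < N)%N -> G xi -> xi != 0 ->
     cmod (cfourier U (uN N) xi) <= A * (h ^+ N * N`!%:R `^ s / enorm xi ^ e N)) ->
  (forall N, (0 < M N)%N /\ (M N)%:R <= N%:R `^ a + 1) ->
  (forall N, Num.floor (N%:R `^ sigma^-1 : R) <= e (M N)) ->
  bounded_cdist_seq U (uN \o M) /\ ext_gevrey_decay_kind kind U (uN \o M) G tau sigma.
Proof.
move=> [cN bN] a01 s0 A0 h0 tau0 sigma0 dec HM He; split.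
  split=> [N|B /bN[m Hm]]; first exact: cN.
  by exists m => N psi; exact: Hm.
have [m Hm] := bN _ (bounded_low_frequencies U).
suff key h' : 0 < h' -> exists2 A' : R, 0 < A' & ext_gevrey_decay U (uN \o M) G tau sigma A' h'.
  case: kind; last exact: key.
  by have [A' A'0 H] := key 1 ltr01; exists A', 1; split.
move=> h'0; have ts0 : 0 < tau / sigma by exact: divr_gt0.
have [A1 A10 HA1] := gevrey_absorb a01 s0 h0 h'0 ts0.
have hi0 : 0 < h'^-1 by rewrite invr_gt0.
have [A2 A20 HA2] := fact_beats_exp hi0 ts0.
exists (A * A1 + (`|m| + 1) * A2).
  by rewrite addr_gt0 ?mulr_gt0 ?ltr_wpDl.
move=> N xi Gxi xi0 /=; set fl := Num.floor _.
have fl0 : 0 <= fl by rewrite floor_ge0 powR_ge0.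
have r0 := enorm_gt0 xi0; set r := enorm xi in r0 *.
set P := h' ^+ N * N`!%:R `^ (tau / sigma).
have P0 : 0 <= P by rewrite mulr_ge0 ?exprn_ge0 ?powR_ge0// ltW.
have rfl0 : 0 < r ^ fl by exact: exprz_gt0.
have AA1 : 0 <= A * A1 by rewrite mulr_ge0 ?ltW.
have AA2 : 0 <= (`|m| + 1) * A2 by rewrite mulr_ge0 ?ltW// ltr_wpDl.
have [r1|r1] := leP 1 r.
  apply: (@le_trans _ _ (A * A1 * (P / r ^ fl))); last first.
    by rewrite ler_wpM2r ?lerDl// divr_ge0 ?(ltW rfl0).
  apply: (le_trans (dec (M N) xi (HM N).1 Gxi xi0)).
  rewrite -[leRHS]mulrA ler_wpM2l ?(ltW A0)// [leRHS]mulrA ler_pM//.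
  - by rewrite mulr_ge0 ?exprn_ge0 ?powR_ge0// ltW.
  - by rewrite invr_ge0 exprz_ge0// ltW.
  - by apply: HA1; exact: (HM N).2.
  - by rewrite lef_pV2 ?posrE ?exprz_gt0//; apply: ler_weXz2l => //; exact: He.
apply: (@le_trans _ _ ((`|m| + 1) * A2 * (P / r ^ fl))); last first.
  by rewrite ler_wpM2r ?lerDr// divr_ge0 ?(ltW rfl0).
apply: (@le_trans _ _ m); first by apply: Hm; exists xi => //; exact: ltW.
apply: (@le_trans _ _ ((`|m| + 1) * 1)).
  by rewrite mulr1 (le_trans (ler_norm m))// lerDl.
rewrite -mulrA ler_wpM2l ?addr_ge0//.
have h1 : 1 <= A2 * P.
  by rewrite /P mulrCA -ler_pdivrMl ?exprn_gt0// mulr1 -exprVn; exact: HA2.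
have AP : 0 <= A2 * P by rewrite mulr_ge0// ltW.
rewrite mulrA (le_trans h1)// ler_peMr//.
rewrite invf_ge1// -(expr0z r); apply: ler_wpiXz2l => //; exact: ltW.
Qed.

End Reindexing.

Section EasyInclusions.
Context {R : realType} {d : nat}.
Local Notation V := 'rV[R]_d.
Local Notation fct := (V -> R[i]).
Implicit Types (U : set V) (u : fct -> R[i]).

Lemma truncnS_bound (x : R) : 0 <= x ->
  (0 < (Num.truncn x).+1)%N /\ (Num.truncn x).+1%:R <= x + 1.
Proof. by move=> x0; split => //; rewrite -natr1 lerD2r truncn_le. Qed.

(** If M(N) is just above N^(sigma/sigma'), then M(N)^(1/sigma) >= N^(1/sigma'), and
sigma/sigma' < 1 leaves room for the factorials. *)
Lemma WF_ext_gevrey_mono kind kind' U u (tau tau' sigma sigma' : R) :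
  1 < sigma -> sigma < sigma' -> 0 < tau -> 0 < tau' ->
  WF_ext_gevrey kind' tau' sigma' U u `<=` WF_ext_gevrey kind tau sigma U u.
Proof.
move=> s1 ss' t0 t'0 p [Up p0 np]; split => //; apply: contra_not np.
have s0 : 0 < sigma := lt_trans ltr01 s1; have s'0 : 0 < sigma' := lt_trans s0 ss'.
move=> [W [G [uN [oW cG bu eu dec]]]].
have [A [h [A0 h0 {}dec]]] : exists A h : R,
    [/\ 0 < A, 0 < h & ext_gevrey_decay U uN G tau sigma A h].
  case: kind dec => // /(_ 1 ltr01)[A A0 H]; by exists A, 1; split.
pose M N := (Num.truncn (N%:R `^ (sigma / sigma') : R)).+1.
have a01 : 0 < sigma / sigma' < 1 by rewrite divr_gt0//= ltr_pdivrMr// mul1r.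
have [||bM dM] := @reindex_decay _ _ kind' U uN G (tau / sigma) A h (sigma / sigma') sigma' tau'
  (fun N => Num.floor (N%:R `^ sigma^-1 : R)) M bu a01 (ltW (divr_gt0 t0 s0)) A0 h0 t'0 s'0
  (fun N xi _ => dec N xi).
- by move=> N; exact: truncnS_bound (powR_ge0 _ _).
- move=> N; apply: le_floor.
  have -> : N%:R `^ sigma'^-1 = (N%:R `^ (sigma / sigma')) `^ sigma^-1 :> R.
    by rewrite -powRrM mulrAC divff ?mul1r// gt_eqF.
  apply: ge0_ler_powR; rewrite ?nnegrE ?powR_ge0// ?invr_ge0 ?(ltW s0)//.
  exact/ltW/truncnS_gt.
by exists W, G, (uN \o M); split => // N; exact: eu.
Qed.

(** The same reindexing with M(N) just above N^(1/sigma): Gevrey regularity is decay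
of order N itself. *)
Lemma WF_ext_gevrey_gevrey kind U u (t tau sigma : R) : 1 < t -> 0 < tau -> 1 < sigma ->
  WF_ext_gevrey kind tau sigma U u `<=` WF_gevrey t U u.
Proof.
move=> t1 tau0 s1 p [Up p0 np]; split => //; apply: contra_not np.
have s0 : 0 < sigma := lt_trans ltr01 s1.
move=> [W [G [uN [oW cG bu eu [A [h [A0 h0 dec]]]]]]].
pose M N := (Num.truncn (N%:R `^ sigma^-1 : R)).+1.
have a01 : 0 < sigma^-1 < 1 by rewrite invr_gt0 s0 invf_lt1.
have [||bM dM] := @reindex_decay _ _ kind U uN G t A h sigma^-1 sigma tau
  Posz M bu a01 (ltW (lt_trans ltr01 t1)) A0 h0 tau0 s0 dec.
- by move=> N; exact: truncnS_bound (powR_ge0 _ _).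
- move=> N; rewrite -(ler_int R) (le_trans (floor_le _))//.
  exact/ltW/truncnS_gt.
by exists W, G, (uN \o M); split => // N; exact: eu.
Qed.

End EasyInclusions.

(** * Decay on cones *)

Section Cones.
Context {R : realType} {d : nat}.
Local Notation V := 'rV[R]_d.
Implicit Types (x xi eta z : V) (G : set V) (k p : nat).

Definition cone_around xi0 (rho : R) : set V :=
  \bigcup_(t in [set t : R | 0 < t]) ball (t *: xi0) (t * rho).

Lemma conic_cone_around xi0 rho : 0 < rho -> conic_nbhd xi0 (cone_around xi0 rho).
Proof.
move=> r0; split.
- by apply: bigcup_open => t /= t0; exact: ball_open.
- move=> s xi s0 [t /= t0 H]; exists (s * t); first exact: mulr_gt0.
  move: H; rewrite -!ball_normE /= -scalerA -scalerBr normrZ gtr0_norm// -mulrA.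
  by rewrite ltr_pM2l.
- by exists 1 => //=; rewrite scale1r mul1r; exact: ballxx.
Qed.

Lemma onenorm_gt0 z : 0 < 1 + `|z|.
Proof. by rewrite ltr_pwDl. Qed.

Lemma onenormX_ge0 z k : 0 <= (1 + `|z|) ^+ k.
Proof. by rewrite exprn_ge0// ltW// onenorm_gt0. Qed.

Lemma onenormD x z : 1 + `|x + z| <= (1 + `|x|) * (1 + `|z|).
Proof.
rewrite mulrDl mul1r mulrDr mulr1 addrA.
rewrite (le_trans (_ : _ <= 1 + `|z| + `|x|)) ?lerDl ?mulr_ge0//.
by rewrite -addrA lerD2l addrC ler_normD.
Qed.

(** Decay of order k on G, up to a polynomial loss in the shift z. *)
Definition peetre_decay G k (F : V -> R[i]) := exists C p, 0 <= C /\
  forall xi z, G xi -> cmod (F (xi + z)) * (1 + `|xi|) ^+ k <= C * (1 + `|z|) ^+ p.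

(** If z is small compared to xi, then xi + z stays in G and (1 + |xi|) <=
(1 + |xi + z|) (1 + |z|). Otherwise |xi| <= c |z|, and powers of 1 + |xi| are paid for
by powers of 1 + |z|. *)
Lemma peetre_decay_cone xi0 rho G k (F : V -> R[i]) (C1 C2 : R) M :
  0 < rho -> (forall xi (t : R), 0 < t -> G xi -> G (t *: xi)) ->
  (forall eta, `|eta - xi0| <= rho -> G eta) -> 0 <= C1 -> 0 <= C2 ->
  (forall eta, cmod (F eta) <= C1 * (1 + `|eta|) ^+ M) ->
  (forall eta, G eta -> cmod (F eta) * (1 + `|eta|) ^+ k <= C2) ->
  peetre_decay (cone_around xi0 (rho / 2)) k F.
Proof.
move=> r0 cG Grho C10 C20 F1 F2.
pose K := `|xi0| + rho / 2; have r20 : 0 < rho / 2 by rewrite divr_gt0.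
have K0 : 0 < K by rewrite ltr_wpDl.
pose c := 2 * K / rho; have c0 : 0 < c by rewrite divr_gt0 ?mulr_gt0.
exists (C2 + C1 * (1 + c) ^+ (M + k)), (M + M + k)%N; split.
  by rewrite addr_ge0// mulr_ge0// exprn_ge0// addr_ge0// ltW.
move=> xi z [t /= t0]; rewrite -ball_normE /= => xit.
have z1 : 1 <= 1 + `|z| by rewrite lerDl.
have xiK : `|xi| <= t * K.
  rewrite -(subrK (t *: xi0) xi) (le_trans (ler_normD _ _))// addrC /K mulrDr lerD//.
    by rewrite normrZ gtr0_norm.
  by rewrite distrC ltW.
have [zt|tz] := leP `|z| (t * (rho / 2)).
  have Gz : G (xi + z).
    rewrite (_ : xi + z = t *: (t^-1 *: (xi + z))); last by rewrite scalerA divff ?scale1r// gt_eqF.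
    apply: cG => //; apply: Grho.
    rewrite -[X in _ - X](_ : t^-1 *: (t *: xi0) = _); last by rewrite scalerA mulVf ?scale1r// gt_eqF.
    rewrite -scalerBr normrZ gtr0_norm ?invr_gt0// ler_pdivrMl//.
    rewrite addrAC (le_trans (ler_normD _ _))//.
    have -> : t * rho = t * (rho / 2) + t * (rho / 2) by field.
    by rewrite lerD// distrC ltW.
  apply: (@le_trans _ _ (C2 * (1 + `|z|) ^+ k)); last first.
    apply: (ler_pM C20 (onenormX_ge0 z k)).
      by rewrite lerDl mulr_ge0// exprn_ge0// addr_ge0// ltW.
    by rewrite ler_weXn2l// leq_addl.
  apply: (@le_trans _ _ (cmod (F (xi + z)) * (1 + `|xi + z|) ^+ k * (1 + `|z|) ^+ k)).
    rewrite -mulrA ler_wpM2l ?cmod_ge0// -exprMn lerXn2r ?nnegrE ?mulr_ge0 ?(ltW (onenorm_gt0 _))//.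
    by have := onenormD (xi + z) (- z); rewrite addrK normrN.
  by rewrite ler_wpM2r ?onenormX_ge0// F2.
have xic : 1 + `|xi| <= (1 + c) * (1 + `|z|).
  have h : `|xi| <= c * `|z|.
    apply: (le_trans xiK); rewrite /c mulrAC ler_pdivlMr//.
    have -> : t * K * rho = 2 * K * (t * (rho / 2)) by field.
    by rewrite ler_wpM2l ?mulr_ge0 ?ltW.
  rewrite mulrDl mul1r mulrDr mulr1; apply: (@le_trans _ _ (1 + c * `|z|)).
    by rewrite lerD2l.
  by rewrite -addrA lerD2l addrA lerDr addr_ge0// ltW.
apply: (@le_trans _ _ (C1 * (1 + c) ^+ (M + k) * (1 + `|z|) ^+ (M + M + k))); last first.
  by rewrite ler_wpM2r ?onenormX_ge0// lerDr.
apply: (@le_trans _ _ (C1 * ((1 + `|xi|) * (1 + `|z|)) ^+ M * (1 + `|xi|) ^+ k)).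
  rewrite ler_wpM2r ?onenormX_ge0// (le_trans (F1 _))// ler_wpM2l// lerXn2r ?nnegrE.
  - by [].
  - exact/ltW/onenorm_gt0.
  - by rewrite mulr_ge0// ltW// onenorm_gt0.
  - exact: onenormD.
rewrite exprMn -!mulrA ler_wpM2l//.
have -> : (1 + `|xi|) ^+ M * ((1 + `|z|) ^+ M * (1 + `|xi|) ^+ k) =
  (1 + `|xi|) ^+ (M + k) * (1 + `|z|) ^+ M by rewrite exprD; ring.
rewrite (_ : (M + M + k = (M + k) + M)%N); last by rewrite addnAC.
rewrite [X in _ <= _ * X]exprD mulrA ler_wpM2r ?onenormX_ge0// -exprMn.
by rewrite lerXn2r ?nnegrE ?mulr_ge0 ?addr_ge0// ltW.
Qed.

End Cones.

(** * Multiplication by functions of one coordinate *)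

Section Multiplication.
Context {R : realType} {d : nat}.
Local Notation V := 'rV[R]_d.
Local Notation fct := (V -> R[i]).
Implicit Types (x xi eta z : V) (G U : set V) (k p : nat) (Phi : fct) (i : 'I_d).

(** The Fourier transform of Phi v. *)
Definition windowed (v : fct -> R[i]) Phi (eta : V) : R[i] :=
  v (fun x => Phi x * fourier_exp eta x).

Lemma fourier_exp_coord i (w : R) x :
  fourier_exp ((w / (2 * pi)) *: delta_mx 0 i) x = cos (w * x 0 i) +i* - sin (w * x 0 i).
Proof.
rewrite /fourier_exp dotvC dotvZl dotvC dotv_delta -sinN -[cos (w * _)]cosN.
have -> : - (2 * pi * (w / (2 * pi) * x 0 i)) = - (w * x 0 i); last by [].
by rewrite mulrA [2 * pi * _]mulrC divfK// mulf_neq0// gt_eqF// pi_gt0.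
Qed.

Lemma trig_term_shift i (a b w : R) eta x :
  (a * cos (w * x 0 i) + b * sin (w * x 0 i))%:C * fourier_exp eta x =
  ((a / 2) +i* (b / 2)) * fourier_exp (eta + (w / (2 * pi)) *: delta_mx 0 i) x +
  ((a / 2) +i* - (b / 2)) * fourier_exp (eta + (- w / (2 * pi)) *: delta_mx 0 i) x.
Proof.
rewrite !fourier_expD !fourier_exp_coord !mulNr cosN sinN opprK.
case: (fourier_exp eta x) => u v; set c := cos _; set s := sin _.
by simpc; congr (_ +i* _); field.
Qed.

Lemma norm_shift_le i (w : R) : `|(w / (2 * pi)) *: (delta_mx 0 i : V)| <= `|w|.
Proof.
have p2 := pi_ge2 R.
have h : 0 < 2 * pi :> R by rewrite mulr_gt0 ?pi_gt0.
apply: norm_le_coord => // j; rewrite !mxE eqxx /= !normrM normfV (gtr0_norm h).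
apply: (@le_trans _ _ (`|w| / (2 * pi) * 1)).
  by apply: ler_wpM2l; [rewrite divr_ge0// ltW|case: eqP; rewrite ?normr0 ?normr1].
by rewrite mulr1 ler_pdivrMr// ler_peMr//; lra.
Qed.

Lemma half_cmod_le (a b : R) : cmod ((a / 2) +i* (b / 2)) <= (`|a| + `|b|) / 2.
Proof. by rewrite (le_trans (cmod_le _ _))// !normrM !normfV normr_nat mulrDl. Qed.

(** Replacing b by a trigonometric sum turns the windowed transform into a
superposition of shifts of the previous one, estimated with the weights of
[trig_approx]; the bound does not depend on the sum, and the error tends to 0 for each
fixed frequency. *)
Lemma peetre_decay_mul U v Phi G k i (b : R -> R) (B0 : R) :
  schwartz_distr U v -> test_fun U Phi -> smooth1 b ->
  (forall t, B0 < `|t| -> b t = 0) ->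
  peetre_decay G k (windowed v Phi) ->
  peetre_decay G k (windowed v (fun x => ridge b (cst 0) (delta_mx 0 i) x * Phi x)).
Proof.
move=> sv tPhi sb bB [C [p [C0 HC]]].
have [sPhi [K [cK KU KPhi]]] := tPhi; have lv := schwartz_linear sv.
have [B [B1 BB0 KB]] : exists B : R, [/\ 1 <= B, B0 <= B & forall x, K x -> `|x 0 i| <= B].
  have [M [_ hM]] := compact_bounded cK.
  exists (1 + `|B0| + `|M|); split.
  - by rewrite -addrA lerDl addr_ge0.
  - by rewrite addrAC (le_trans (ler_norm _))// lerDr addr_ge0.
  - move=> x Kx; apply: (le_trans (le_coord_norm x i)); apply: hM => //.
    by rewrite (le_lt_trans (ler_norm M))// ltr_pwDl.
have {bB}bB t : B < `|t| -> b t = 0 by move=> h; apply: bB; exact: le_lt_trans h.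
have [D [k0 [D0 HD]]] := schwartz_bound sv cK KU.
have [Cw Cw0 HCw] := trig_approx p k0 sb bB B1.
have tw (Psi : fct) eta : test_fun U Psi -> test_fun U (fun x => Psi x * fourier_exp eta x).
  move=> tPsi; rewrite (_ : (fun x => _) = fun x => fourier_exp eta x * Psi x).
    by apply: (test_funM _ tPsi); exact: smooth_fourier_exp.
  by apply/funext => x; rewrite mulrC.
exists (C * Cw), p; split; first exact: mulr_ge0.
move=> xi z Gxi; apply/ler_addgt0Pr => e e0.
set eta := xi + z; set X := (1 + `|xi|) ^+ k.
have X0 : 0 < X by rewrite exprn_gt0// onenorm_gt0.
have Z0 := onenormX_ge0 z p.
have sPe : smooth_on setT (fun x => Phi x * fourier_exp eta x).
  exact: (smoothM sPhi (smooth_fourier_exp eta)).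
have [A HA] := jet_le_exists k0 cK sPe.
pose Q := D * (2 ^+ k0 * `|A|) * X.
have Q0 : 0 <= Q by rewrite mulr_ge0 ?(ltW X0)// mulr_ge0// mulr_ge0// exprn_ge0.
have [l [Hl Hap]] := HCw (e / (Q + 1)) (divr_gt0 e0 (ltr_wpDl Q0 ltr01)).
set e' := e / (Q + 1) in Hap.
have e'0 : 0 < e' by rewrite divr_gt0// ltr_wpDl.
pose T := trig_sum l.
have sT : smooth1 T by exact: smooth1_trig_sum.
have sTb : smooth1 (fun s => T s - b s).
  rewrite (_ : (fun s => T s - b s) = T \+ (cst (-1) \* b)).
    exact: (smooth1D sT (smooth1M (smooth1_cst _) sb)).
  by apply/funext => s /=; rewrite mulN1r.
pose rT := ridge T (cst 0) (delta_mx 0 i : V).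
pose rb := ridge b (cst 0) (delta_mx 0 i : V).
pose rD := ridge (fun s => T s - b s) (cst 0) (delta_mx 0 i : V).
have s0 := @smooth1_cst R 0.
(* The jet of Phi e_eta depends on eta; the accuracy e' is chosen after eta. *)
have errD : cmod (v (fun x => rD x * (Phi x * fourier_exp eta x))) * X <= e.
  apply: (@le_trans _ _ (D * (2 ^+ k0 * e' * `|A|) * X)).
    rewrite ler_wpM2r ?(ltW X0)//; apply: HD.
    - exact: (smoothM (smooth_ridge _ sTb s0) sPe).
    - by move=> x nKx; rewrite KPhi// mul0r mulr0.
    - by rewrite mulr_ge0// mulr_ge0 ?exprn_ge0// ltW.
    move=> x Kx; apply: jet_leM.
    - exact: smooth_ridge sTb s0.
    - exact: sPe.
    - by apply: (jet_le_ridge_coord sTb) => j jk; apply: Hap => //; exact: KB.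
    - by move=> s sk; apply: (le_trans (HA x Kx s sk)); exact: ler_norm.
  rewrite (_ : _ * X = Q * e'); last by rewrite /Q; ring.
  by rewrite /e' mulrCA ger_pMr// ler_pdivrMr ?mul1r ?lerDl// ltr_wpDl.
have split_v : windowed v (fun x => rb x * Phi x) eta =
   v (fun x => rT x * (Phi x * fourier_exp eta x)) -
   v (fun x => rD x * (Phi x * fourier_exp eta x)).
  rewrite -(linear_testB lv).
  - rewrite /windowed; congr v; apply/funext => x.
    rewrite -mulrBl mulrA; congr (_ * _ * _); rewrite /rb /rT /rD /ridge; simpc.
    by congr (_ +i* _); ring.
  - by apply: test_funM; [exact: smooth_ridge sT s0|exact: tw].
  - by apply: test_funM; [exact: smooth_ridge sTb s0|exact: tw].
rewrite -/rb split_v; apply: (@le_trans _ _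
  (cmod (v (fun x => rT x * (Phi x * fourier_exp eta x))) * X +
   cmod (v (fun x => rD x * (Phi x * fourier_exp eta x))) * X)).
  by rewrite -mulrDl ler_wpM2r ?(ltW X0)// (le_trans (le_cmodD _ _))// cmodN.
rewrite lerD//.
pose dl (w : R) : V := (w / (2 * pi)) *: delta_mx 0 i.
have -> : v (fun x => rT x * (Phi x * fourier_exp eta x)) =
   \sum_(q <- l) (((q.1.1 / 2) +i* (q.1.2 / 2)) * windowed v Phi (eta + dl q.2) +
     ((q.1.1 / 2) +i* - (q.1.2 / 2)) * windowed v Phi (eta + dl (- q.2))).
  pose F (q : R * R * R) x :=
    ((q.1.1 / 2) +i* (q.1.2 / 2)) * (Phi x * fourier_exp (eta + dl q.2) x) +
    ((q.1.1 / 2) +i* - (q.1.2 / 2)) * (Phi x * fourier_exp (eta + dl (- q.2)) x).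
  transitivity (v (fun x => \sum_(q <- l) F q x)).
    congr v; apply/funext => x; rewrite /rT /ridge /T /trig_sum dotv_delta.
    rewrite -/(real_complex R _) rmorph_sum /= mulr_suml; apply: eq_bigr => q _.
    by rewrite mulrCA trig_term_shift /F mulrDr; congr (_ + _); rewrite mulrCA.
  have tF q : test_fun U (F q).
    by apply: test_funD; (apply: test_funM; [exact: smooth_cst|exact: tw]).
  rewrite (linear_test_sum lv _ tF); apply: eq_bigr => q _.
  rewrite /F (linear_testD lv); [|by apply: test_funM; [exact: smooth_cst|exact: tw]..].
  by rewrite !(linear_testZ lv _ (tw _ _ tPhi)).
apply: (@le_trans _ _ (\sum_(q <- l) (`|q.1.1| + `|q.1.2|) * (1 + `|q.2|) ^+ p *
   (C * (1 + `|z|) ^+ p))); last first.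
  by rewrite -mulr_suml mulrC mulrAC ler_wpM2r// ler_wpM2l.
rewrite (le_trans (ler_wpM2r (ltW X0) (le_cmod_sum _ _)))// mulr_suml.
apply: ler_sum => q _.
have bnd w : `|w| = `|q.2| -> cmod (windowed v Phi (eta + dl w)) * X <=
    (1 + `|q.2|) ^+ p * (C * (1 + `|z|) ^+ p).
  move=> wq; rewrite /eta -addrA (le_trans (HC _ _ Gxi))// mulrCA ler_wpM2l//.
  rewrite -exprMn lerXn2r ?nnegrE ?mulr_ge0 ?addr_ge0//.
  rewrite (le_trans (onenormD _ _))// mulrC ler_wpM2r ?addr_ge0// lerD2l -wq.
  exact: norm_shift_le.
have term (c : R[i]) w : cmod c <= (`|q.1.1| + `|q.1.2|) / 2 -> `|w| = `|q.2| ->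
    cmod (c * windowed v Phi (eta + dl w)) * X <=
    (`|q.1.1| + `|q.1.2|) / 2 * ((1 + `|q.2|) ^+ p * (C * (1 + `|z|) ^+ p)).
  move=> hc wq; rewrite cmodM -mulrA ler_pM ?cmod_ge0//; last exact: bnd.
  by rewrite mulr_ge0 ?cmod_ge0// ltW.
apply: (le_trans (ler_wpM2r (ltW X0) (le_cmodD _ _))); rewrite mulrDl.
rewrite (_ : _ * _ * _ = (`|q.1.1| + `|q.1.2|) / 2 * ((1 + `|q.2|) ^+ p * (C * (1 + `|z|) ^+ p)) +
  (`|q.1.1| + `|q.1.2|) / 2 * ((1 + `|q.2|) ^+ p * (C * (1 + `|z|) ^+ p))); last by field.
apply: lerD; apply: term => //.
- exact: half_cmod_le.
- by rewrite -mulNr (le_trans (half_cmod_le _ _))// normrN.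
- by rewrite normrN.
Qed.

End Multiplication.

(** * The classical wave front set *)

Section ClassicalWF.
Context {R : realType} {d : nat}.
Local Notation V := 'rV[R]_d.
Local Notation fct := (V -> R[i]).
Implicit Types (x xi eta z : V) (G U W : set V) (k p : nat).

(** The order of v gives the exponent: derivatives of exponentials are polynomial
in the frequency. *)
Lemma windowed_poly_bound U v chi : schwartz_distr U v -> test_fun U chi ->
  exists (C : R) M, 0 <= C /\ forall eta, cmod (windowed v chi eta) <= C * (1 + `|eta|) ^+ M.
Proof.
move=> sv [schi [K [cK KU Kchi]]].
have [D [k0 [D0 HD]]] := schwartz_bound sv cK KU.
have [A HA] := jet_le_exists k0 cK schi.
have p0 : 0 <= 2 * pi :> R by rewrite mulr_ge0 ?pi_ge0.
exists (D * (2 ^+ k0 * `|A| * (1 + 2 * pi) ^+ k0)), k0; split.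
  by rewrite !mulr_ge0 ?exprn_ge0// addr_ge0.
move=> eta; have q0 : 0 <= 2 * pi * `|eta| by rewrite mulr_ge0.
apply: (@le_trans _ _ (D * (2 ^+ k0 * `|A| * (1 + 2 * pi * `|eta|) ^+ k0))).
  apply: HD.
  - exact: (smoothM schi (smooth_fourier_exp eta)).
  - by move=> x nKx; rewrite Kchi// mul0r.
  - by rewrite mulr_ge0 ?exprn_ge0 ?addr_ge0// mulr_ge0// exprn_ge0.
  move=> x Kx; apply: jet_leM.
  - exact: schi.
  - exact: smooth_fourier_exp.
  - by move=> s sk; apply: (le_trans (HA x Kx s sk)); exact: ler_norm.
  - exact: jet_le_fourier_exp.
rewrite -[leRHS]mulrA ler_wpM2l// -[leRHS]mulrA ler_wpM2l ?mulr_ge0 ?exprn_ge0// -exprMn.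
rewrite lerXn2r ?nnegrE ?mulr_ge0 ?addr_ge0//.
have -> : (1 + 2 * pi) * (1 + `|eta|) = (1 + 2 * pi * `|eta|) + (2 * pi + `|eta|) by ring.
by rewrite lerDl addr_ge0.
Qed.

Lemma peetre_decay_bump U v chi G k (s : seq 'I_d) x0 (r : R) : 0 < r ->
  schwartz_distr U v -> test_fun U chi -> peetre_decay G k (windowed v chi) ->
  peetre_decay G k (windowed v (fun x => bump_over s x0 r x * chi x)).
Proof.
move=> r0 sv tchi Hchi; elim: s => [|i s IH].
  rewrite (_ : (fun x => _) = chi)//.
  by apply/funext => x; rewrite /bump_over big_nil mul1r.
rewrite (_ : (fun x => _) = fun x => coord_bump x0 r i x * (bump_over s x0 r x * chi x)).
  apply: (@peetre_decay_mul _ _ U _ _ _ _ _ _ (r + `|x0 0 i|)) => //.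
  - by apply: test_funM => //; exact: smooth_bump_over.
  - by apply: smooth1_affine; exact: smooth1_bump1.
  - move=> t tr; apply: bump1_eq0; rewrite -mulrBr normrM gtr0_norm ?invr_gt0//.
    rewrite ler_pdivlMl// mulr1 (le_trans _ (lerB_normD _ _))//.
    by rewrite normrN lerBrDr ltW.
by apply/funext => x; rewrite /bump_over big_cons mulrA.
Qed.

Lemma WF_sub_ext_gevrey kind U u (tau sigma : R) : open U -> schwartz_distr U u ->
  0 < tau -> 1 < sigma -> WF U u `<=` WF_ext_gevrey kind tau sigma U u.
Proof.
move=> oU su tau0 s1 [x0 xi0] [/= Ux0 xi0n np]; split => //=; apply: contra_not np.
move=> [W [G [uN [[oW WU Wx0] [oG cG Gxi0] [cuN _] eu dec]]]].
have s0 : 0 < sigma := lt_trans ltr01 s1.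
have {}dec : exists A h : R, [/\ 0 < A, 0 < h & ext_gevrey_decay U uN G tau sigma A h].
  case: kind dec => // /(_ 1 ltr01)[A A0 H]; by exists A, 1; split.
have [A [h [A0 h0 {}dec]]] := dec.
have [r r0 rW] := open_cball oW Wx0.
have [rho rho0 rhoG] := open_cball oG Gxi0.
have tW := test_fun_bump r0 rW; have tU := test_funS WU tW.
exists (bump x0 r), (cone_around xi0 (rho / 2)); split => //.
- by rewrite bump_eq1 ?subrr ?normr0 ?divr_ge0 ?(ltW r0)// oner_neq0.
- by apply: conic_cone_around; rewrite divr_gt0.
move=> k.
(* N is large enough for the floor of N^(1/sigma) to reach k. *)
pose N := (Num.truncn (k%:R `^ sigma : R)).+1.
have kfl : k%:Z <= Num.floor (N%:R `^ sigma^-1 : R).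
  rewrite floor_ge_int; apply: (@le_trans _ _ ((k%:R `^ sigma) `^ sigma^-1)).
    by rewrite -powRrM divff ?gt_eqF// powRr1.
  apply: ge0_ler_powR; rewrite ?nnegrE ?powR_ge0// ?invr_ge0 ?(ltW s0)//.
  exact/ltW/truncnS_gt.
set v := uN N; have [sv cv] := cuN N; have lv := schwartz_linear sv.
have [chi cchi] := compact_distr_cutoff oU (cuN N); have [tchi _] := cchi.
have EF eta : cfourier U v eta = windowed v chi eta.
  exact: (cpairE oU lv cchi (smooth_fourier_exp eta)).
have [C1 [M [C10 HC1]]] := windowed_poly_bound sv tchi.
pose A' := A * (h ^+ N * N`!%:R `^ (tau / sigma)).
have A'0 : 0 <= A' by rewrite mulr_ge0 ?mulr_ge0 ?exprn_ge0 ?powR_ge0 ?ltW.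
(* Decay in terms of 1 + |eta|: low frequencies are covered by the polynomial bound. *)
have HC2 eta : G eta -> cmod (windowed v chi eta) * (1 + `|eta|) ^+ k <=
    A' * 2 ^+ k + C1 * 2 ^+ M * 2 ^+ k.
  move=> Geta; have [e1|e1] := leP `|eta| 1.
    apply: (@le_trans _ _ (C1 * 2 ^+ M * 2 ^+ k)); last by rewrite lerDr mulr_ge0 ?exprn_ge0.
    have e2 : 1 + `|eta| <= 2 by lra.
    apply: ler_pM; [exact: cmod_ge0|exact: onenormX_ge0| |].
      by rewrite (le_trans (HC1 _))// ler_wpM2l// lerXn2r ?nnegrE ?addr_ge0.
    by rewrite lerXn2r ?nnegrE ?addr_ge0.
  have e0 : eta != 0 by apply: contraTneq e1 => ->; rewrite normr0 ltNge ler01.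
  have en1 : 1 <= enorm eta by rewrite (le_trans (ltW e1)) ?norm_le_enorm.
  have en0 : 0 < enorm eta := lt_le_trans ltr01 en1.
  apply: (@le_trans _ _ (A' * 2 ^+ k)); last by rewrite lerDl !mulr_ge0 ?exprn_ge0.
  rewrite -EF (le_trans (ler_wpM2r (onenormX_ge0 _ _) (dec N eta Geta e0)))//.
  rewrite mulrA -/A' mulrAC ler_pdivrMr ?exprz_gt0// -[leRHS]mulrA ler_wpM2l//.
  apply: (@le_trans _ _ ((2 * enorm eta) ^+ k)).
    rewrite lerXn2r ?nnegrE ?mulr_ge0 ?addr_ge0 ?(ltW en0)//.
    by have := norm_le_enorm eta; lra.
  rewrite exprMn ler_wpM2l ?exprn_ge0//.
  exact: (ler_weXz2l en1 kfl).
have [|C [p [C0 HC]]] := peetre_decay_bump (enum 'I_d) x0 r0 sv tchi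
  (peetre_decay_cone rho0 (fun xi t => cG t xi) rhoG C10 _ HC1 HC2).
  have p2 n : 0 <= 2 ^+ n :> R by exact: exprn_ge0.
  by apply: addr_ge0; [exact: mulr_ge0|apply: mulr_ge0; [exact: mulr_ge0|]].
exists (C * (1 + d%:R) ^+ k) => xi Gxi.
have d1 : 0 < 1 + d%:R :> R by rewrite ltr_pwDl.
have en0 : 0 < 1 + enorm xi by rewrite ltr_pwDl ?sqrtr_ge0.
have := HC xi 0 Gxi; rewrite addr0 normr0 addr0 expr1n mulr1.
have -> : windowed v (fun x => bump_over (enum 'I_d) x0 r x * chi x) xi =
    cfourier U (dist_mul (bump x0 r) u) xi.
  rewrite (cfourier_mul xi oU (schwartz_linear su) tU).
  have tbe Z : test_fun Z (bump x0 r) ->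
      test_fun Z (fun x => bump x0 r x * fourier_exp xi x).
    move=> tb; rewrite (_ : (fun x => _) = fun x => fourier_exp xi x * bump x0 r x).
      by apply: (test_funM _ tb); exact: smooth_fourier_exp.
    by apply/funext => x; rewrite mulrC.
  rewrite -(eu N _ (tbe _ tW)) -[RHS](cutoff_mul_test oU lv cchi (tbe _ tU)).
  by rewrite /windowed; congr v; apply/funext => x; rewrite /bump; ring.
move=> H; rewrite ler_pdivlMr ?exprn_gt0//.
apply: (@le_trans _ _ (cmod (cfourier U (dist_mul (bump x0 r) u) xi) *
    ((1 + d%:R) * (1 + `|xi|)) ^+ k)).
  rewrite ler_wpM2l ?cmod_ge0// lerXn2r ?nnegrE ?(ltW en0) ?mulr_ge0 ?(ltW d1) ?addr_ge0//.
  have := enorm_le_norm xi; have := normr_ge0 xi; rewrite mulrDl mul1r mulrDr mulr1.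
  have : 0 <= d%:R :> R by [].
  lra.
by rewrite exprMn mulrCA mulrC ler_wpM2r ?exprn_ge0 ?(ltW d1).
Qed.

End ClassicalWF.

Theorem corollary3p1 (R : realType) (d : nat) (U : set 'rV[R]_d)
    (u : ('rV[R]_d -> R[i]) -> R[i]) (kind : WF_kind) :
  open U -> schwartz_distr U u ->
  [/\ WF U u `<=` WF_0_1 kind U u,
      WF_0_1 kind U u `<=` WF_oo_1 kind U u,
      WF_oo_1 kind U u `<=` WF_0_oo kind U u,
      WF_0_oo kind U u `<=` WF_oo_oo kind U u &
      WF_oo_oo kind U u `<=` \bigcap_(t in [set t : R | 1 < t]) WF_gevrey t U u].
Proof.
move=> oU su; split.
- by move=> p WFp s /= s1 t /= t0; exact: (WF_sub_ext_gevrey kind oU su t0 s1 WFp).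
- by move=> p H s s1; exists 1; [rewrite /= ltr01|apply: (H s s1); rewrite /= ltr01].
(* For sigma = 2 every tau is reached from the one tau given for sigma = 3. *)
- move=> p H; exists 2; first by rewrite /= ltr1n.
  move=> t /= t0; have [|t' /= t'0 Hp] := H 3; first by rewrite /= ltr1n.
  by apply: WF_ext_gevrey_mono Hp; rewrite ?ltr1n// ltr_nat.
- by move=> p [s s1 H]; exists s => //; exists 1; [rewrite /= ltr01|apply: H; rewrite /= ltr01].
- move=> p [s /= s1 [tau /= tau0 H]] t /= t1.
  exact: (WF_ext_gevrey_gevrey t1 tau0 s1 H).
Qed.
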